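(* Let $(M,g)$ be a semi-Riemannian manifold of dimension $n>2$, let $V$ be a vector field on $M$, and let $\nabla$ be the metric connection with vectorial torsion $V$. Then the following conditions are equivalent: (1) the $V$-curvature satisfies $\mathcal{R}^V(X,Y,Z,W)=\mathcal{R}^V(Z,W,X,Y)$ for all vector fields $X,Y,Z,W$; (2) the $V$-Ricci tensor $\mathrm{Ric}^V$ is symmetric; (3) the $1$-form $V^\flat=g(V,\cdot)$ is closed, $dV^\flat=0$.
   Context: Let $\nabla^g$ be the Levi-Civita connection of $(M,g)$. The metric connection with vectorial torsion $V$ is $\nabla_XY=\nabla^g_XY+g(X,Y)V-g(V,Y)X$. Its curvature is $\mathcal{R}^V(X,Y)Z=\nabla_X\nabla_YZ-\nabla_Y\nabla_XZ-\nabla_{[X,Y]}Z$, and $\mathcal{R}^V(X,Y,Z,W)=g(\mathcal{R}^V(X,Y)Z,W)$. For a local orthonormal basis $e_1,\dots,e_n$ with $g(e_i,e_j)=\varepsilon_i\delta_{ij}$, $\varepsilon_i=\pm1$, one sets $\mathrm{Ric}^V(X,Y)=\sum_i\varepsilon_i\,g(\mathcal{R}^V(X,e_i)e_i,Y)$. *)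

(* Defs.v *)
From HB Require Import structures.
From mathcomp Require Import all_boot all_order all_algebra.
From mathcomp Require Import all_classical all_reals all_analysis.
From mathcomp Require Import ring.

Set Implicit Arguments.
Unset Strict Implicit.
Unset Printing Implicit Defensive.

Import Order.TTheory GRing.Theory Num.Theory numFieldNormedType.Exports.

Local Open Scope classical_set_scope.
Local Open Scope ring_scope.

Section SmoothMaps.
Context {R : realType} {V W : normedModType R}.

(* Class C^k on an open set D: the Frechet derivative exists on D and each
   directional derivative is of class C^(k-1).  Only used with D open. *)
Fixpoint Ck (k : nat) (D : set V) (f : V -> W) : Prop :=
  if k is k'.+1 then
    (forall x, D x -> differentiable f x) /\
    (forall v, Ck k' D (fun x => 'D_v f x))
  else forall x, D x -> continuous_at x f.

Definition smooth_on (D : set V) (f : V -> W) : Prop := forall k, Ck k D f.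

Lemma near0_differentiable (z : V -> W) (x : V) :
  (\forall y \near x, z y = 0) -> differentiable z x.
Proof.
move=> z0; have zx : z x = 0 := nbhs_singleton z0.
have dz : z \o shift x = cst (z x) + (\0 : V -> W) +o_ 0 id.
  apply/eqaddoP => e e0; rewrite zx.
  move: z0; rewrite (near_shift 0 x) subr0 => z0.
  apply: filterS z0 => h zh.
  by rewrite !fctE /= zh addr0 subr0 normr0 mulr_ge0 // ltW.
have d0 : 'd z x = \0 :> (V -> W).
  by apply: diff_unique dz; exact: cst_continuous.
by apply/diff_locallyP; rewrite d0; split => //; exact: cst_continuous.
Qed.

Lemma near_differentiable (f h : V -> W) (x : V) :
  (\forall y \near x, f y = h y) -> differentiable f x -> differentiable h x.
Proof.
move=> fh df; rewrite (_ : h = f + (h - f)); last by rewrite addrC subrK.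
apply: differentiableD => //; apply: near0_differentiable.
by apply: filterS fh => y fhy; rewrite !fctE fhy subrr.
Qed.

Lemma Ck_ext k (D : set V) (f h : V -> W) : open D ->
  (forall x, D x -> f x = h x) -> Ck k D f -> Ck k D h.
Proof.
move=> oD; have near_eq (f1 h1 : V -> W) : (forall x, D x -> f1 x = h1 x) ->
    forall x, D x -> \forall y \near x, f1 y = h1 y.
  by move=> fh x Dx; apply: filterS (open_nbhs_nbhs (conj oD Dx)).
elim: k f h => [|k IH] f h fh /=.
  move=> cf x Dx; rewrite /continuous_at -(fh _ Dx).
  by apply: cvg_trans (cf x Dx); apply: near_eq_cvg; exact: near_eq Dx.
move=> [df Df]; split=> [x Dx|v].
  exact: near_differentiable (near_eq _ _ fh _ Dx) (df _ Dx).
by apply: IH (Df v) => x Dx; apply: near_eq_derive; exact: near_eq Dx.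
Qed.

Lemma CkS k (D : set V) (f : V -> W) : Ck k.+1 D f -> Ck k D f.
Proof.
elim: k f => [|k IH] f /= [df Df].
  by move=> x Dx; apply: differentiable_continuous; exact: df.
by split=> // v; apply: IH; exact: Df.
Qed.

Lemma Ck_cst k (D : set V) (a : W) : Ck k D (fun=> a).
Proof.
elim: k a => [|k IH] a /=; first by move=> x _; exact: cvg_cst.
split=> [x _|v]; first exact: differentiable_cst.
have -> : (fun x => 'D_v (fun=> a) x) = fun=> 0 :> W; last exact: IH.
by apply/funext => x; exact: derive_cst.
Qed.

Lemma Ck_lin k (D : set V) (a : R) (f h : V -> W) : open D ->
  Ck k D f -> Ck k D h -> Ck k D (fun x => a *: f x + h x).
Proof.
move=> oD; elim: k f h => [|k IH] f h /=.
  move=> cf ch x Dx; apply: (@continuousD _ _ _ (a \*: f) h); last exact: ch.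
  exact: (@continuousZ _ _ _ (cst a) f x (@cst_continuous _ _ _ _) (cf x Dx)).
move=> [df Df] [dh Dh].
have da x : D x -> differentiable (a \*: f) x.
  by move=> Dx; apply: differentiableZ; exact: df.
split=> [x Dx|v]; first by apply: differentiableD; [exact: da|exact: dh].
apply: Ck_ext oD _ (IH _ _ (Df v) (Dh v)) => x Dx /=.
have dfx := diff_derivable (df x Dx); have dhx := diff_derivable (dh x Dx).
have dax := diff_derivable (da x Dx).
by rewrite (@deriveD _ _ _ (a \*: f) h) // deriveZ.
Qed.

End SmoothMaps.

Lemma Ck_mul (R : realType) (V : normedModType R) k (D : set V) (f h : V -> R) :
  open D -> Ck k D f -> Ck k D h -> Ck k D (fun x => f x * h x).
Proof.
move=> oD; elim: k f h => [|k IH] f h.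
  by move=> cf ch x Dx; apply: continuousM; [exact: cf|exact: ch].
move=> fk hk; have [fk' hk'] := (CkS fk, CkS hk).
case: fk hk => [df Df] [dh Dh].
split=> [x Dx|v]; first by apply: differentiableM; [exact: df|exact: dh].
have := Ck_lin 1 oD (IH _ _ fk' (Dh v)) (IH _ _ hk' (Df v)).
apply: Ck_ext => // x Dx; rewrite scale1r.
have dfx := diff_derivable (df x Dx); have dhx := diff_derivable (dh x Dx).
by rewrite (@deriveM _ _ f h) // addrC [h x *: _]mulrC.
Qed.

Section Charts.
Variables (R : realType) (n : nat) (M : topologicalType).

(* A homeomorphism from an open set of M onto an open set of R^n; only the
   values of coord on dom and of param on img are meaningful. *)
Record chart := Chart {
  dom : set M;
  img : set 'rV[R]_n;
  coord : M -> 'rV[R]_n;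
  param : 'rV[R]_n -> M;
  dom_open : open dom;
  img_open : open img;
  coord_img : forall p, dom p -> img (coord p);
  param_dom : forall x, img x -> dom (param x);
  coordK : forall p, dom p -> param (coord p) = p;
  paramK : forall x, img x -> coord (param x) = x;
  coord_continuous : forall p, dom p -> continuous_at p coord;
  param_continuous : forall x, img x -> continuous_at x param }.

End Charts.

Record manifold (R : realType) (n : nat) := Manifold {
  mspace :> topologicalType;
  atlas : set (chart R n mspace);
  mspace_hausdorff : hausdorff_space mspace;
  mspace_second_countable : @second_countable mspace;
  atlas_cover : forall p, exists2 c, atlas c & dom c p;
  atlas_compatible : forall c1 c2, atlas c1 -> atlas c2 ->
    smooth_on (coord c1 @` (dom c1 `&` dom c2)) (coord c2 \o param c1) }.

Section SmoothFunctions.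
Context {R : realType} {n : nat} (M : manifold R n).

Definition smooth (f : M -> R) : Prop :=
  forall c, atlas c -> smooth_on (img c) (f \o param c).

Definition smooth_pred : {pred M -> R} := fun f => `[< smooth f >].

Lemma smooth_subring : subring_closed smooth_pred.
Proof.
split.
- by apply/asboolP => c _ k; exact: (@Ck_cst R _ R).
- move=> f h /asboolP sf /asboolP sh; apply/asboolP => c ac k.
  have := Ck_lin (-1) (@img_open _ _ _ c) (sh c ac k) (sf c ac k).
  by apply: Ck_ext; [exact: img_open|move=> x _ /=; rewrite scaleN1r addrC].
- move=> f h /asboolP sf /asboolP sh; apply/asboolP => c ac k.
  exact: Ck_mul (@img_open _ _ _ c) (sf c ac k) (sh c ac k).
Qed.

Lemma smooth_scale : GRing.scaler_closed smooth_pred.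
Proof.
move=> a f /asboolP sf; apply/asboolP => c ac k.
have := Ck_lin a (@img_open _ _ _ c) (sf c ac k) (@Ck_cst R _ R k _ 0).
by apply: Ck_ext; [exact: img_open|move=> x _ /=; rewrite addr0].
Qed.

HB.instance Definition _ :=
  GRing.isSubringClosed.Build (M -> R) smooth_pred smooth_subring.
HB.instance Definition _ :=
  GRing.isScaleClosed.Build R (M -> R) smooth_pred smooth_scale.

Record smooth_fun := SmoothFun {
  smooth_val :> M -> R;
  smooth_valP : smooth_val \in smooth_pred }.

HB.instance Definition _ := [isSub for smooth_val].
HB.instance Definition _ := [Choice of smooth_fun by <:].
HB.instance Definition _ :=
  GRing.SubChoice_isSubComPzRing.Build (M -> R) smooth_pred smooth_fun
    (subringClosedP _).
HB.instance Definition _ := [SubZmodule_isSubLmodule of smooth_fun by <:].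

Definition mk_smooth (f : M -> R) (sf : smooth f) : smooth_fun :=
  SmoothFun (introT (asboolP _) sf).

End SmoothFunctions.

Section TangentVectors.
Context {R : realType} {n : nat} {M : manifold R n}.
Notation F := (smooth_fun M).

Lemma smooth_funP (f h : F) : (forall p, f p = h p) -> f = h.
Proof. by move=> fh; apply/val_inj/funext. Qed.

Definition derivation_at (p : M) (v : F -> R) : Prop :=
  (forall a f h, v (a *: f + h) = a * v f + v h) /\
  (forall f h, v (f * h) = v f * h p + f p * v h).

Definition derivation_pred (p : M) : {pred F -> R} :=
  fun v => `[< derivation_at p v >].

Lemma derivation_submod p : subsemimod_closed (derivation_pred p).
Proof.
split; first split.
- apply/asboolP; split=> [a f h|f h]; rewrite /GRing.zero/=.
    by rewrite mulr0 addr0.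
  by rewrite mul0r mulr0 addr0.
- move=> u v /asboolP[lu du] /asboolP[lv dv]; apply/asboolP.
  have E w : (u + v) w = u w + v w by [].
  by split=> [a f h|f h]; rewrite !E ?lu ?lv ?du ?dv; ring.
- move=> a v /asboolP[lv dv]; apply/asboolP.
  have E w : (a *: v) w = a * v w by [].
  by split=> [b f h|f h]; rewrite !E ?lv ?dv; ring.
Qed.

HB.instance Definition _ p :=
  GRing.isSubmodClosed.Build R (F -> R) (derivation_pred p)
    (derivation_submod p).

Record tangent (p : M) := Tangent {
  tangent_val :> F -> R;
  tangent_valP : tangent_val \in derivation_pred p }.

HB.instance Definition _ p := [isSub for @tangent_val p].
HB.instance Definition _ p := [Choice of tangent p by <:].
HB.instance Definition _ p := [SubChoice_isSubLmodule of tangent p by <:].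

Lemma tangentP p (u v : tangent p) : (forall f, u f = v f) -> u = v.
Proof. by move=> uv; apply/val_inj/funext. Qed.

Lemma tangent_lin p (v : tangent p) a f h : v (a *: f + h) = a * v f + v h.
Proof. by case/asboolP: (tangent_valP v) => + _; apply. Qed.

Lemma tangentM p (v : tangent p) f h : v (f * h) = v f * h p + f p * v h.
Proof. by case/asboolP: (tangent_valP v) => _; apply. Qed.

Definition mk_tangent p (v : F -> R) (dv : derivation_at p v) : tangent p :=
  Tangent (introT (asboolP _) dv).

Record vfield := VField {
  vfield_at :> forall p : M, tangent p;
  vfield_smooth : forall f : F, smooth (fun p => vfield_at p f : R) }.

Definition vact (X : vfield) (f : F) : F := mk_smooth (vfield_smooth X f).

Lemma vfieldP (X Y : vfield) : (forall p, X p = Y p) -> X = Y.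
Proof.
case: X Y => [X sX] [Y sY] /= XY.
have eXY : X = Y by apply/functional_extensionality_dep.
by case: _ / eXY in sY *; congr VField; exact: Prop_irrelevance.
Qed.

Lemma smooth_val_smooth (f : F) : smooth (f : M -> R).
Proof. exact/asboolP/(smooth_valP f). Qed.

Lemma smooth_ext (f : F) (h : M -> R) : (forall p, f p = h p) -> smooth h.
Proof. by move=> /funext <-; exact: smooth_val_smooth. Qed.

HB.instance Definition _ := gen_eqMixin vfield.
HB.instance Definition _ := gen_choiceMixin vfield.

Program Definition vzero : vfield := @VField (fun p => 0) _.
Next Obligation. by move=> f; apply: (@smooth_ext 0). Qed.

Program Definition vadd (X Y : vfield) : vfield :=
  @VField (fun p => X p + Y p) _.
Next Obligation. by move=> X Y f; apply: (@smooth_ext (vact X f + vact Y f)). Qed.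

Program Definition vopp (X : vfield) : vfield := @VField (fun p => - X p) _.
Next Obligation. by move=> X f; apply: (@smooth_ext (- vact X f)). Qed.

Program Definition vscale (h : F) (X : vfield) : vfield :=
  @VField (fun p => h p *: X p) _.
Next Obligation. by move=> h X f; apply: (@smooth_ext (h * vact X f)). Qed.

Fact vaddA : associative vadd.
Proof. by move=> X Y Z; apply: vfieldP => p; exact: addrA. Qed.
Fact vaddC : commutative vadd.
Proof. by move=> X Y; apply: vfieldP => p; exact: addrC. Qed.
Fact vadd0 : left_id vzero vadd.
Proof. by move=> X; apply: vfieldP => p; exact: add0r. Qed.
Fact vaddN : left_inverse vzero vopp vadd.
Proof. by move=> X; apply: vfieldP => p; exact: addNr. Qed.

HB.instance Definition _ :=
  GRing.isZmodule.Build vfield vaddA vaddC vadd0 vaddN.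

Fact vscaleA (f h : F) X : vscale f (vscale h X) = vscale (f * h) X.
Proof. by apply: vfieldP => p; exact: scalerA. Qed.
Fact vscale1 : left_id 1 vscale.
Proof. by move=> X; apply: vfieldP => p; exact: scale1r. Qed.
Fact vscaleDr : right_distributive vscale +%R.
Proof. by move=> h X Y; apply: vfieldP => p; exact: scalerDr. Qed.
Fact vscaleDl X : {morph vscale^~ X : f h / f + h}.
Proof. by move=> f h; apply: vfieldP => p; exact: scalerDl. Qed.

HB.instance Definition _ :=
  GRing.Zmodule_isLmodule.Build F vfield vscaleA vscale1 vscaleDr vscaleDl.

Fact bracket_derivation (X Y : vfield) (p : M) :
  derivation_at p (fun f => X p (vact Y f) - Y p (vact X f)).
Proof.
have lin (Z : vfield) a f h : vact Z (a *: f + h) = a *: vact Z f + vact Z h.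
  by apply: smooth_funP => q; exact: tangent_lin.
have leib (Z : vfield) f h : vact Z (f * h) = h * vact Z f + f * vact Z h.
  apply: smooth_funP => q; rewrite [h * _]mulrC; exact: tangentM.
have add (v : tangent p) f h : v (f + h) = v f + v h.
  by have := tangent_lin v 1 f h; rewrite scale1r mul1r.
split=> [a f h|f h]; first by rewrite !lin !tangent_lin; ring.
rewrite !leib !add !tangentM /vact/=; ring.
Qed.

(* Lie bracket: [X, Y] f = X (Y f) - Y (X f). *)
Program Definition bracket (X Y : vfield) : vfield :=
  @VField (fun p => mk_tangent (bracket_derivation X Y p)) _.
Next Obligation.
by move=> X Y f; apply: (@smooth_ext (vact X (vact Y f) - vact Y (vact X f))).
Qed.

End TangentVectors.
Arguments vfield {R n} M.

Section SemiRiemannian.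
Context {R : realType} {n : nat} {M : manifold R n}.

(* The index of a symmetric bilinear form on T_pM: the largest dimension of a
   subspace on which it is negative definite. *)
Definition negative_family p (b : tangent p -> tangent p -> R) k
    (u : 'I_k -> tangent (M := M) p) : Prop :=
  forall a : 'I_k -> R, (exists i, a i != 0) ->
    b (\sum_i a i *: u i) (\sum_i a i *: u i) < 0.

Definition has_index p (b : tangent (M := M) p -> tangent p -> R) nu : Prop :=
  (exists u : 'I_nu -> tangent p, negative_family b u) /\
  (forall k (u : 'I_k -> tangent p), negative_family b u -> (k <= nu)%N).

End SemiRiemannian.

Record semi_metric (R : realType) (n : nat) (M : manifold R n) := SemiMetric {
  metric_at : forall p : M, tangent p -> tangent p -> R;
  metric_linear : forall (p : M) a (u v w : tangent p),
    metric_at (a *: u + v) w = a * metric_at u w + metric_at v w;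
  metric_sym : forall (p : M) (u v : tangent p), metric_at u v = metric_at v u;
  metric_nondegenerate : forall (p : M) (u : tangent p),
    (forall v, metric_at u v = 0) -> u = 0;
  metric_smooth : forall X Y : vfield M,
    smooth (fun p => metric_at (X p) (Y p));
  metric_index : exists nu, forall p : M, has_index (@metric_at p) nu }.

Section Connections.
Context {R : realType} {n : nat} {M : manifold R n}.
Variable g : semi_metric M.
Implicit Types (X Y Z W V : vfield M) (D : vfield M -> vfield M -> vfield M).

Definition metric X Y : smooth_fun M := mk_smooth (metric_smooth g X Y).

Record is_connection D : Prop := IsConnection {
  connectionDl : forall X Y Z, D (X + Y) Z = D X Z + D Y Z;
  connectionZl : forall f X Y, D (f *: X) Y = f *: D X Y;
  connectionDr : forall X Y Z, D X (Y + Z) = D X Y + D X Z;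
  connectionZr : forall f X Y, D X (f *: Y) = vact X f *: Y + f *: D X Y }.

Record is_levi_civita D : Prop := IsLeviCivita {
  levi_civita_connection : is_connection D;
  levi_civita_torsion : forall X Y, D X Y - D Y X = bracket X Y;
  levi_civita_metric : forall X Y Z,
    vact X (metric Y Z) = metric (D X Y) Z + metric Y (D X Z) }.

Definition vectorial_connection D V X Y : vfield M :=
  D X Y + metric X Y *: V - metric V Y *: X.

Definition curvature D X Y Z : vfield M :=
  D X (D Y Z) - D Y (D X Z) - D (bracket X Y) Z.

Definition curvature4 D X Y Z W : smooth_fun M := metric (curvature D X Y Z) W.

(* Curvature being tensorial, a local frame is represented by global vector
   fields that are orthonormal on an open set U: a frame defined only on a
   neighborhood of p agrees near p with its product by a cut-off function. *)
Definition orthonormal_frame (U : set M) (e : 'I_n -> vfield M)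
    (eps : 'I_n -> R) : Prop :=
  (forall i, eps i = 1 \/ eps i = -1) /\
  (forall p, U p -> forall i j, metric (e i) (e j) p = eps i *+ (i == j)).

Definition frame_near (p : M) : set (('I_n -> vfield M) * ('I_n -> R)) :=
  [set b | exists2 U, open_nbhs p U & orthonormal_frame U b.1 b.2].

(* Every p has an orthonormal frame near it; the default value 0 of xget is
   never used, and the Ricci tensor does not depend on the chosen frame. *)
Definition local_frame (p : M) : ('I_n -> vfield M) * ('I_n -> R) :=
  xget (fun=> 0, fun=> 0) (frame_near p).

Definition ricci D X Y (p : M) : R :=
  let: (e, eps) := local_frame p in
  \sum_i eps i * metric (curvature D X (e i) (e i)) Y p.

Definition flat V X : smooth_fun M := metric V X.

(* Exterior derivative of a 1-form, evaluated on vector fields. *)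
Definition dform (w : vfield M -> smooth_fun M) X Y : smooth_fun M :=
  vact X (w Y) - vact Y (w X) - w (bracket X Y).

End Connections.

(* Main.v *)
(* Write [w = g(V, .)], [O = dw] and let [R] be the Levi-Civita curvature. Expanding
   the definition gives [R^V = R + ] terms in [g] and
   [A(X, W) = g(D_X V, W) + w(X) w(W)]; since [R] has the pair symmetry and
   [O(X, Y) = A(X, Y) - A(Y, X)],
     [R^V(X,Y,Z,W) - R^V(Z,W,X,Y) =
        g(Y,Z) O(X,W) - g(Y,W) O(X,Z) - g(X,Z) O(Y,W) + g(X,W) O(Y,Z)].
   This gives (3) => (1), and (1) => (2) is immediate from the skew-symmetries
   of [R^V]. Tracing the identity over an orthonormal frame [e_i],
     [Ric^V(X,Y) - Ric^V(Y,X) = n O(X,Y) - sum_i eps_i g(e_i,Y) O(X,e_i)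
                                - sum_i eps_i g(X,e_i) O(e_i,Y)],
   so a symmetric [Ric^V] forces [(n-2) O(e_a,e_b) = 0], then
   [(n-1) O(e_a,Y) = 0], then [n O(X,Y) = 0].

   This needs a frame near every point. Hadamard's lemma shows that derivations
   at [p] are spanned by the [n] coordinate vectors, which bump functions extend
   to global fields; Gram-Schmidt then applies, because if the remaining
   vectors were totally isotropic, nondegeneracy would make them vanish. *)
From HB Require Import structures.
Require Import Defs.
From mathcomp Require Import all_boot all_order all_algebra.
From mathcomp Require Import all_classical all_reals all_analysis.
From mathcomp Require Import ring lra.

Set Implicit Arguments.
Unset Strict Implicit.
Unset Printing Implicit Defensive.

Import Order.TTheory GRing.Theory Num.Theory numFieldNormedType.Exports.

Local Open Scope classical_set_scope.
Local Open Scope ring_scope.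

(** * Locality, algebra and composition of maps of class [C^k] *)

Section CkTheory.
Context {R : realType}.
Implicit Types V W : normedModType R.

(** Derivatives are taken of the total function, so [D] only lists the points where the conditions
    are tested. Regularity on a singleton then acts as a local condition, and smoothness can be
    proved one point at a time. *)
Lemma Ck_pointwise V W k (D : set V) (f : V -> W) :
  Ck k D f <-> forall x, D x -> Ck k [set x] f.
Proof.
elim: k f => [|k IH] f /=.
  by split=> [cf x Dx y ->|cf x Dx]; [exact: cf|exact: cf Dx x erefl].
split=> [[df Df] x Dx|H].
  split=> [y ->|v]; first exact: df.
  by have /IH := Df v; apply.
split=> [x Dx|v]; first by case: (H x Dx) => + _; apply.
by apply/IH => x Dx; case: (H x Dx).
Qed.

Lemma Ck_sub V W k (D E : set V) (f : V -> W) : E `<=` D -> Ck k D f -> Ck k E f.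
Proof. by move=> ED /Ck_pointwise Df; apply/Ck_pointwise => x /ED; exact: Df. Qed.

Lemma Ck_near V W k (D : set V) (f h : V -> W) (x : V) : open D -> D x ->
  Ck k D f -> (\forall y \near x, f y = h y) -> Ck k [set x] h.
Proof.
move=> oD Dx Df; rewrite /prop_near1 nbhsE => -[U [oU Ux] Ufh].
have := @Ck_ext R V W k (D `&` U) f h (openI oD oU).
move=> /(_ (fun y Uy => Ufh y Uy.2)) /(_ (Ck_sub (@subIsetl _ _ _) Df)).
by apply: Ck_sub => y ->.
Qed.

Lemma Ck_linear V W k (D : set V) (l : {linear V -> W}) :
  continuous l -> Ck k D l.
Proof.
move=> cl; case: k => [|k] /=; first by move=> x _; exact: cl.
split=> [x _|v]; first exact: linear_differentiable.
rewrite (_ : (fun x => _) = fun=> l v); first exact: Ck_cst.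
apply/funext => x; rewrite deriveE; last exact: linear_differentiable.
by rewrite diff_lin.
Qed.

Lemma CkD V W k (D : set V) (f h : V -> W) : open D ->
  Ck k D f -> Ck k D h -> Ck k D (fun x => f x + h x).
Proof.
move=> oD Df Dh; apply: Ck_ext (oD) _ (Ck_lin 1 oD Df Dh) => x _.
by rewrite scale1r.
Qed.

Lemma CkZ V W k (D : set V) a (f : V -> W) : open D ->
  Ck k D f -> Ck k D (fun x => a *: f x).
Proof.
move=> oD Df; apply: Ck_ext (oD) _ (Ck_lin a oD Df (Ck_cst k D 0)) => x _.
by rewrite addr0.
Qed.

Lemma CkB V W k (D : set V) (f h : V -> W) : open D ->
  Ck k D f -> Ck k D h -> Ck k D (fun x => f x - h x).
Proof.
move=> oD Df Dh; apply: Ck_ext (oD) _ (Ck_lin (-1) oD Dh Df) => x _.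
by rewrite scaleN1r addrC.
Qed.

Lemma Ck_sum V W k (D : set V) n (f : 'I_n -> V -> W) : open D ->
  (forall i, Ck k D (f i)) -> Ck k D (fun x => \sum_i f i x).
Proof.
move=> oD; elim: n f => [|n IH] f Df.
  by apply: Ck_ext (oD) _ (Ck_cst k D 0) => x _; rewrite big_ord0.
apply: Ck_ext (oD) _ (CkD oD (IH (f \o lift ord0) (fun i => Df _)) (Df ord0)).
by move=> x _; rewrite big_ord_recl addrC.
Qed.

Lemma Ck_prod V k (D : set V) n (f : 'I_n -> V -> R) : open D ->
  (forall i, Ck k D (f i)) -> Ck k D (fun x => \prod_i f i x).
Proof.
move=> oD; elim: n f => [|n IH] f Df.
  by apply: Ck_ext (oD) _ (@Ck_cst _ _ R k D 1) => x _; rewrite big_ord0.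
apply: Ck_ext (oD) _ (Ck_mul oD (IH (f \o lift ord0) (fun i => Df _)) (Df ord0)).
by move=> x _; rewrite big_ord_recl mulrC.
Qed.

Lemma Ck_lin_comp V W W' k (D : set V) (l : {linear W -> W'}) (f : V -> W) :
  open D -> continuous l -> Ck k D f -> Ck k D (l \o f).
Proof.
move=> oD cl; elim: k f => [|k IH] f /=.
  by move=> cf x Dx; apply: continuous_comp; [exact: cf|exact: cl].
move=> [df Df]; split=> [x Dx|v].
  by apply: differentiable_comp; [exact: df|exact: linear_differentiable].
apply: Ck_ext (oD) _ (IH _ (Df v)) => x Dx /=.
have dfx := df x Dx; have dl := linear_differentiable (f x) (cl : continuous l).
rewrite (deriveE _ dfx) (deriveE _ (differentiable_comp dfx dl)).
by rewrite (diff_comp dfx dl) /= (diff_lin _ cl).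
Qed.

(* The chain rule needs a basis [e] of [W] with coordinate functionals [l], so
   that the differential of [h] is a combination of its directional
   derivatives. *)
Lemma Ck_comp V W n (e : 'I_n -> W) (l : 'I_n -> {linear W -> R}) k
    (D : set V) (E : set W) (f : V -> W) (h : W -> R) :
  (forall j, continuous (l j)) -> (forall w, w = \sum_j l j w *: e j) ->
  open D -> (forall x, D x -> E (f x)) -> Ck k D f -> Ck k E h ->
  Ck k D (h \o f).
Proof.
move=> cl el oD DE; elim: k f DE h => [|k IH] f DE h.
  move=> cf ch x Dx; apply: continuous_comp; first exact: cf.
  by apply: ch; exact: DE.
move=> fk hk; have [fk' hk'] := (CkS fk, CkS hk).
case: fk hk => [df Df] [dh Dh]; split=> [x Dx|v].
  by apply: differentiable_comp; [exact: df|apply: dh; exact: DE].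
have S j := Ck_mul oD (Ck_lin_comp oD (cl j) (Df v)) (IH f DE _ fk' (Dh (e j))).
apply: Ck_ext (oD) _ (Ck_sum oD S) => x Dx /=.
have dfx := df x Dx; have dhx := dh _ (DE x Dx).
rewrite (deriveE _ (differentiable_comp dfx dhx)) (diff_comp dfx dhx) /=.
rewrite -(deriveE v dfx) [in RHS](el ('D_v f x)) linear_sum.
by apply: eq_bigr => j _; rewrite linearZ /= -(deriveE _ dhx).
Qed.

Lemma Ck_comp1 V k (D : set V) (E : set R) (f : V -> R) (h : R -> R) :
  open D -> (forall x, D x -> E (f x)) -> Ck k D f -> Ck k E h ->
  Ck k D (h \o f).
Proof.
apply: (@Ck_comp V R 1 (fun=> 1) (fun=> idfun)).
- by move=> _ x; exact: cvg_id.
- by move=> w; rewrite big_ord1 /= /GRing.scale/= mulr1.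
Qed.

Definition rV_coord n (j : 'I_n) (x : 'rV[R]_n) : R := x 0 j.

Fact rV_coord_linear n (j : 'I_n) : linear (rV_coord j).
Proof. by move=> a x y; rewrite /rV_coord !mxE. Qed.
HB.instance Definition _ n (j : 'I_n) :=
  GRing.isLinear.Build R 'rV[R]_n R *:%R (rV_coord j) (rV_coord_linear j).

Lemma rV_coord_continuous n (j : 'I_n) : continuous (rV_coord j).
Proof. by move=> x; exact: coord_continuous. Qed.

Lemma Ck_rV_coord n k (D : set 'rV[R]_n) j : Ck k D (rV_coord j).
Proof. by apply: Ck_linear; exact: rV_coord_continuous. Qed.

Lemma rV_decomp n (x : 'rV[R]_n) : x = \sum_j rV_coord j x *: delta_mx 0 j.
Proof. by rewrite [LHS]row_sum_delta. Qed.

Lemma Ck_comp_rV V n k (D : set V) (E : set 'rV[R]_n) (f : V -> 'rV[R]_n)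
    (h : 'rV[R]_n -> R) :
  open D -> (forall x, D x -> E (f x)) -> Ck k D f -> Ck k E h ->
  Ck k D (h \o f).
Proof.
apply: (@Ck_comp V 'rV[R]_n n (fun j => delta_mx 0 j) (fun j => rV_coord j)).
- by move=> j; exact: rV_coord_continuous.
- exact: rV_decomp.
Qed.

(** Every direction in [R] is a multiple of [1], so all directional derivatives are multiples of the
    single function [d]. *)
Lemma CkS_derive1 k (D : set R) (f d : R -> R) : open D ->
  (forall x, D x -> is_derive x 1 f (d x)) -> Ck k D d -> Ck k.+1 D f.
Proof.
move=> oD fd dk; split=> [x /fd[dfx _]|v]; first exact/derivable1_diffP.
apply: Ck_ext (oD) _ (CkZ v oD dk) => x /fd[dfx <-].
rewrite !deriveE; try exact/derivable1_diffP.
by rewrite -linearZ /= /GRing.scale/= mulr1.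
Qed.

End CkTheory.

(** * The flat function [exp(-1/x)] and its smoothness at 0 *)

Section FlatFunction.
Context {R : realType}.
Implicit Types (m : nat) (x : R).

(** The case [m = 0] is the classical flat function. Derivatives stay in the span of this family, so
    the induction on [k] in [Ck_flatf] treats all [m] at once. *)
Definition flatf m x : R := if 0 < x then x ^- m * expR (- x^-1) else 0.

(** For positive [m], [exp y = (exp (y/m))^m] and [exp (y/m) >= 1 + y/m >= y/m]. *)
Lemma expr_le_expR m (y : R) : 0 <= y -> y ^+ m <= m%:R ^+ m * expR y.
Proof.
move=> y0; case: m => [|m]; first by rewrite !expr0 mul1r -expR0 ler_expR.
have m0 : 0 < m.+1%:R :> R by rewrite ltr0n.
have -> : expR y = expR (y / m.+1%:R) ^+ m.+1.
  by rewrite -expRM_natl mulrC divfK // gt_eqF.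
rewrite -exprMn ler_pXn2r ?nnegrE ?mulr_ge0 ?expR_ge0 //.
rewrite -ler_pdivrMl // mulrC; apply: le_trans (expR_ge1Dx _).
by rewrite lerDr.
Qed.

(** This is [expr_le_expR] at [y = 1/x] with exponent [m.+1]; the extra power of [1/x] pays for the
    factor [|x|]. *)
Lemma flatf_norm_le m x : `|flatf m x| <= m.+1%:R ^+ m.+1 * `|x|.
Proof.
rewrite /flatf; case: ifPn => [x0|_]; last by rewrite normr0 mulr_ge0.
have y0 : 0 <= x^-1 by rewrite invr_ge0 ltW.
rewrite (ger0_norm (ltW x0)) ger0_norm; last first.
  by rewrite mulr_ge0 ?expR_ge0 ?invr_ge0 ?exprn_ge0 ?ltW.
rewrite expRN ler_pdivrMr ?expR_gt0 // mulrAC -ler_pdivrMr //.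
by rewrite -exprVn -exprSr expr_le_expR.
Qed.

Lemma is_derive_flatf m x :
  is_derive x 1 (flatf m) (flatf m.+2 x - m%:R * flatf m.+1 x).
Proof.
have [x0|x0|->] := ltgtP x 0.
- have f0 i y : y < 0 -> flatf i y = 0 by move=> y0; rewrite /flatf ltNge ltW.
  rewrite !f0 // mulr0 subr0.
  apply: near_eq_is_derive (is_derive_cst (0 : R) x (1 : R)).
  near=> y; rewrite f0 //; near: y.
  by apply: open_nbhs_nbhs; split => //; exact: open_lt.
- have fE i y : 0 < y -> flatf i y = y^-1 ^+ i * expR (- y^-1).
    by move=> y0; rewrite /flatf y0 exprVn.
  rewrite !fE //; have x1 : x != 0 by rewrite gt_eqF.
  have dV : is_derive x 1 (fun y : R => y^-1) (- x ^- 2).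
    have -> : - x ^- 2 = - x ^- 2 *: (1 : R) by rewrite /GRing.scale/= mulr1.
    apply: DeriveDef; first exact: (@derivableV _ _ id).
    by rewrite (@deriveV _ _ id) // derive_id.
  have dE : is_derive x 1 (expR \o (fun y : R => - y^-1))
      (expR (- x^-1) * - - x ^- 2).
    by apply: is_derive1_comp; exact: is_deriveN.
  apply: (@near_eq_is_derive _ _ _
    ((fun y : R => y^-1) ^+ m * (expR \o (fun y : R => - y^-1)))).
    near=> y; rewrite fE ?fctE //; near: y.
    by apply: open_nbhs_nbhs; split => //; exact: open_gt.
  apply: is_derive_eq; rewrite /GRing.scale /=.
  rewrite -!exprVn !fctE; case: m => [|i]; first by rewrite !mul0r; ring.
  by rewrite !exprS /=; ring.
- have f0 i : flatf i 0 = 0 by rewrite /flatf ltxx.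
  rewrite !f0 mulr0 subr0.
  (* At 0 the difference quotient of [flatf m] is [flatf m.+1] itself, which tends to 0 by the
     linear bound. *)
  have D0 : (fun h : R => h^-1 *: ((flatf m \o shift 0) (h *: 1) - flatf m 0))
      @ 0^' --> (0 : R).
    apply/cvgrPdist_le => e e0; near=> h.
    have h0 : h != 0 by near: h; exact: nbhs_dnbhs_neq.
    have -> : h^-1 *: ((flatf m \o shift 0) (h *: 1) - flatf m 0) = flatf m.+1 h.
      rewrite f0 subr0 /= addr0 /GRing.scale /= mulr1 /flatf.
      by case: ifPn; rewrite ?mulr0 // mulrA -invfM -exprS.
    rewrite sub0r normrN; apply: le_trans (flatf_norm_le _ _) _.
    rewrite -ler_pdivlMl ?exprn_gt0 // mulrC; apply: ltW; near: h.
    apply: dnbhs0_lt; rewrite divr_gt0 ?exprn_gt0 //.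
  by apply: DeriveDef; [apply: cvgP D0|apply: cvg_lim D0].
Unshelve. all: by end_near.
Qed.

Lemma Ck_flatf m k (D : set R) : open D -> Ck k D (flatf m).
Proof.
move=> oD; elim: k m => [|k IH] m.
  move=> x _; apply: differentiable_continuous; apply/derivable1_diffP.
  by have [] := is_derive_flatf m x.
apply: CkS_derive1 (oD) (fun x _ => is_derive_flatf m x) _.
exact: CkB oD (IH _) (CkZ _ oD (IH _)).
Qed.

Lemma flatf0_gt0 x : (0 < flatf 0 x) = (0 < x).
Proof.
rewrite /flatf; case: (ltP 0 x) => [x0|_]; last by rewrite ltxx.
by rewrite invr1 mul1r expR_gt0.
Qed.

Lemma flatf_ge0 m x : 0 <= flatf m x.
Proof.
rewrite /flatf; case: ifPn => // x0.
by rewrite mulr_ge0 ?expR_ge0 // invr_ge0 exprn_ge0 // ltW.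
Qed.

End FlatFunction.

(** The derivative is [a] times the power with exponent [a - 1], hence the induction over all
    exponents. *)
Lemma Ck_powR (R : realType) k (a : R) : Ck k [set x : R | 0 < x] (@powR R ^~ a).
Proof.
elim: k a => [|k IH] a.
  move=> x x0; apply: differentiable_continuous; apply/derivable1_diffP.
  by have [] := is_derive1_powR a x0.
have o0 : open [set x : R | 0 < x] by exact: open_gt.
apply: CkS_derive1 (o0) (fun x x0 => is_derive1_powR a x0) _.
exact: (CkZ a o0 (IH (a - 1))).
Qed.

(** * Integration of continuous functions over the unit interval *)

Section UnitIntervalIntegral.
Context {R : realType}.
Notation mu := (@lebesgue_measure R).
Implicit Types f h : R -> R.

(** Continuity is two-sided even at 0 and 1: the integrands below are restrictions of functions
    differentiable around the segment. *)
Definition continuous01 f := forall t : R, 0 <= t <= 1 -> continuous_at t f.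

Definition integral01 f : R := \int[mu]_(t in `[0, 1]%classic) f t.

Lemma continuous01_within f : continuous01 f -> {within `[0, 1], continuous f}.
Proof.
move=> cf; apply: continuous_in_subspaceT => t.
by rewrite inE /= in_itv /=; exact: cf.
Qed.

Lemma continuous01_integrable f : continuous01 f ->
  mu.-integrable `[0, 1]%classic (EFin \o f).
Proof.
move=> cf; apply: continuous_compact_integrable; first exact: segment_compact.
exact: continuous01_within.
Qed.

Lemma continuous01B f h : continuous01 f -> continuous01 h ->
  continuous01 (fun t => f t - h t).
Proof. by move=> cf ch t t01; exact: (continuousB (cf t t01) (ch t t01)). Qed.

Lemma continuous01Z a f : continuous01 f -> continuous01 (fun t => a * f t).
Proof.
move=> cf t t01; apply: (@continuousM R R (fun=> a) f t); last exact: cf.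
exact: cst_continuous.
Qed.

Lemma integral01B f h : continuous01 f -> continuous01 h ->
  integral01 (fun t => f t - h t) = integral01 f - integral01 h.
Proof. by move=> cf ch; apply: RintegralB => //; exact: continuous01_integrable. Qed.

Lemma integral01Z a f : continuous01 f ->
  integral01 (fun t => a * f t) = a * integral01 f.
Proof. by move=> cf; apply: RintegralZl => //; exact: continuous01_integrable. Qed.

Lemma integral01_cst a : integral01 (fun=> a) = a.
Proof.
rewrite /integral01 Rintegral_cst //= lebesgue_measure_itv /= lte_fin ltr01.
by rewrite oppr0 adde0 mulr1.
Qed.

Lemma continuous01_sum n (f : 'I_n -> R -> R) :
  (forall i, continuous01 (f i)) -> continuous01 (fun t => \sum_i f i t).
Proof.
by move=> cf t t01; apply: cvg_big => [|i _]; [exact: add_continuous|exact: cf].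
Qed.

Lemma integral01_sum n (f : 'I_n -> R -> R) :
  (forall i, continuous01 (f i)) ->
  integral01 (fun t => \sum_i f i t) = \sum_i integral01 (f i).
Proof.
elim: n f => [|n IH] f cf.
  rewrite big_ord0 -[RHS](integral01_cst 0); congr integral01.
  by apply/funext => t; rewrite big_ord0.
rewrite big_ord_recl -IH // -RintegralD //; last 2 first.
- exact: continuous01_integrable.
- by apply: continuous01_integrable; apply: continuous01_sum.
by congr integral01; apply/funext => t; rewrite big_ord_recl.
Qed.

Lemma integral01_norm_le f a : continuous01 f ->
  (forall t : R, 0 <= t <= 1 -> `|f t| <= a) -> `|integral01 f| <= a.
Proof.
move=> cf fa; have i1 := continuous01_integrable cf.
apply: le_trans (le_normr_Rintegral _ i1) _ => //.
rewrite -[leRHS]integral01_cst; apply: le_Rintegral.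
- exact: measurable_itv.
- by apply: continuous01_integrable => t t01; apply: cvg_norm; exact: cf.
- by apply: continuous01_integrable => t _; exact: cvg_cst.
- by move=> t /=; rewrite in_itv /=; exact: fa.
Qed.

Lemma integral01_derive f h : continuous01 h ->
  (forall t : R, 0 <= t <= 1 -> is_derive t 1 f (h t)) -> integral01 h = f 1 - f 0.
Proof.
move=> ch fh; rewrite /integral01 /Rintegral.
have cf (t : R) : 0 <= t <= 1 -> continuous_at t f.
  move=> /fh [df _]; apply: differentiable_continuous.
  exact/derivable1_diffP.
rewrite (@continuous_FTC2 _ h f) //; first exact: continuous01_within.
  split.
  - move=> t; rewrite in_itv /= => /andP[t0 t1].
    by have [] := fh t _; rewrite ?(ltW t0) ?(ltW t1).
  - by apply: cvg_at_right_filter; apply: cf; rewrite lexx ler01.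
  - by apply: cvg_at_left_filter; apply: cf; rewrite lexx ler01.
move=> t; rewrite in_itv /= => /andP[t0 t1]; rewrite derive1E.
by have [] := fh t _; rewrite ?(ltW t0) ?(ltW t1).
Qed.

End UnitIntervalIntegral.

(** A quadratic error is [o(|h|)], so [l] is the differential. This is the tool for differentiating
    an integral: a Taylor bound uniform in the integration variable integrates to such an error. *)
Lemma quadratic_differentiable (R : realType) (V W : normedModType R)
    (f : V -> W) (l : {linear V -> W}) (x : V) (K : R) : continuous l ->
  (\forall y \near x, `|f y - f x - l (y - x)| <= K * `|y - x| ^+ 2) ->
  differentiable f x /\ forall v, 'D_v f x = l v.
Proof.
move=> cl fK.
have dc : f \o shift x = cst (f x) + l +o_ 0 id.
  apply/eqaddoP => e e0.
  move: fK; rewrite (near_shift 0 x) subr0 => fK.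
  near=> h.
  have : `|f (h + x) - f x - l (h + x - x)| <= K * `|h + x - x| ^+ 2.
    by near: h.
  rewrite !addrK => H; rewrite !fctE /= opprD addrA.
  apply: le_trans H _; rewrite expr2 mulrA ler_wpM2r //.
  (* [K] may be zero or negative; [|K| + 1] dominates it and can be divided by. *)
  have K0 : 0 < `|K| + 1 by rewrite ltr_wpDl.
  apply: le_trans (_ : (`|K| + 1) * `|h| <= _).
    by rewrite ler_wpM2r // ler_wpDr // ler_norm.
  rewrite -ler_pdivlMl // ltW //; near: h; apply: nbhs0_lt.
  by rewrite mulr_gt0 ?invr_gt0 // ltr_wpDl.
have dfx : 'd f x = l :> (V -> W).
  by apply: diff_unique dc.
have df : differentiable f x.
  by apply/diff_locallyP; rewrite dfx; split.
by split=> // v; rewrite deriveE // dfx.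
Unshelve. all: by end_near. Qed.

(** * Partial derivatives and derivatives along lines *)

Section Taylor.
Context {R : realType} {n : nat}.
Notation rV := 'rV[R]_n.
Implicit Types (f : rV -> R) (x z v w : rV).

Definition partial (j : 'I_n) f : rV -> R := fun x => 'D_(delta_mx 0 j) f x.

Lemma derive_partial f x v : differentiable f x ->
  'D_v f x = \sum_j v 0 j * partial j f x.
Proof.
move=> df; rewrite deriveE // [in LHS](rV_decomp v) linear_sum.
by apply: eq_bigr => j _; rewrite linearZ /= /partial deriveE.
Qed.

Lemma is_derive_line f z w (s : R) : differentiable f (z + s *: w) ->
  is_derive s 1 (fun t : R => f (z + t *: w)) ('D_w f (z + s *: w)).
Proof.
move=> df; have dw : derivable f (z + s *: w) w by exact: diff_derivable.
have E : (fun h : R => h^-1 *: (((fun t : R => f (z + t *: w)) \o shift s) (h *: 1)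
      - f (z + s *: w))) =
    (fun h : R => h^-1 *: ((f \o shift (z + s *: w)) (h *: w) - f (z + s *: w))).
  apply/funext => h /=; congr (_ *: (f _ - _)).
  by rewrite [_%:A]mulr1 scalerDl addrCA.
by apply: DeriveDef; rewrite /derivable /derive E.
Qed.

Lemma norm_coord_le v j : `|v 0 j| <= `|v|.
Proof.
rewrite [leRHS]mx_normrE.
exact: (le_bigmax _ (fun i : 'I_1 * 'I_n => `|v i.1 i.2|) (0, j)).
Qed.

(** The linear form with coefficients [c], named so that it can carry the linear structure required
    of a differential. *)
Definition comb_rV (c : 'I_n -> R) v : R := \sum_j v 0 j * c j.

Fact comb_rV_linear c : linear (comb_rV c).
Proof.
move=> a u v; rewrite /comb_rV scaler_sumr -big_split /=.
by apply: eq_bigr => j _; rewrite !mxE mulrDl -mulrA.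
Qed.
HB.instance Definition _ c :=
  GRing.isLinear.Build R rV R *:%R (comb_rV c) (comb_rV_linear c).

Lemma comb_rV_continuous c : continuous (comb_rV c).
Proof.
apply: continuous_big => [|j _ v]; first exact: add_continuous.
apply: (@continuousM _ _ (fun u : rV => u 0 j) (fun=> c j)).
  exact: coord_continuous.
exact: cst_continuous.
Qed.

End Taylor.

(** * Bounds on balls and a second-order Taylor estimate *)

Section Hadamard.
Context {R : realType} {n : nat}.
Notation rV := 'rV[R]_n.
Implicit Types (D : set rV) (f : rV -> R) (a x y z w : rV) (t s : R).

Lemma smooth_on_partial D f j : smooth_on D f -> smooth_on D (partial j f).
Proof. by move=> sf k; have [_] := sf k.+1; apply. Qed.

Lemma smooth_on_differentiable D f x : smooth_on D f -> D x -> differentiable f x.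
Proof. by move=> sf; have [+ _] := sf 1%N; apply. Qed.

Lemma smooth_on_continuous D f x : smooth_on D f -> D x -> continuous_at x f.
Proof. by move=> sf; apply: sf 0%N _. Qed.

Lemma open_lt_norm a r : open [set x | `|x - a| < r].
Proof.
rewrite (_ : [set x | _] = ball a r); first exact: ball_open.
by apply/seteqP; split=> x; rewrite -ball_normE /= distrC.
Qed.

Lemma compact_le_norm a r : compact [set x | `|x - a| <= r].
Proof.
apply: bounded_closed_compact.
  exists (`|a| + r); split; first by rewrite num_real.
  move=> M rM x /= xa; apply: le_trans (ltW rM).
  by rewrite -(subrK a x) (le_trans (ler_normD _ _)) // addrC lerD2l.
have cB : continuous (fun x => x - a).
  by move=> x; apply: (@continuousB _ _ _ id (cst a)) => //; exact: cst_continuous.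
have cN : {in ~` (fun x => `|x - a|) @^-1` [set s | s <= r],
    continuous (fun x => `|x - a|)}.
  by move=> x _; exact: (continuous_comp (cB x) (@norm_continuous _ _ _)).
exact: preimage_closed cN (@closed_le _ r).
Qed.

Lemma le_norm_bounded D f a r : 0 < r -> (forall x, `|x - a| <= r -> D x) ->
  (forall x, D x -> continuous_at x f) ->
  exists K, forall x, `|x - a| <= r -> `|f x| <= K.
Proof.
move=> r0 BD cf.
have [|||c cB cK] := @EVT_max_rV R n (fun x => `|f x|) [set x | `|x - a| <= r].
- by exists a; rewrite /= subrr normr0 ltW.
- exact: compact_le_norm.
- apply: continuous_in_subspaceT => x; rewrite inE /= => /BD Dx.
  exact: (continuous_comp (cf x Dx) (@norm_continuous _ _ _)).
- by exists `|f c| => x xB; apply: cK; rewrite inE.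
Qed.

Lemma le_norm_sum_coord w (d : 'I_n -> R) K : (forall j, `|d j| <= K) ->
  `|\sum_j w 0 j * d j| <= n%:R * (`|w| * K).
Proof.
move=> dK; apply: le_trans (ler_norm_sum _ _ _) _.
have -> : n%:R * (`|w| * K) = \sum_(j < n) `|w| * K.
  by rewrite sumr_const card_ord mulr_natl.
apply: ler_sum => j _.
by rewrite normrM ler_pM // norm_coord_le.
Qed.

Lemma mvt_line f z w t : 0 <= t <= 1 ->
  (forall s, 0 <= s <= 1 -> differentiable f (z + s *: w)) ->
  exists2 s, 0 <= s <= 1 & f (z + t *: w) - f z = t * 'D_w f (z + s *: w).
Proof.
move=> /andP[t0 t1] df.
have dg s : 0 <= s <= 1 -> is_derive s 1 (fun u => f (z + u *: w))
    ('D_w f (z + s *: w)) by move=> /df; exact: is_derive_line.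
have [s|  |s sI] := @MVT_segment R (fun u => f (z + u *: w))
    (fun u => 'D_w f (z + u *: w)) 0 t t0.
- rewrite in_itv /= => /andP[s0 st]; apply: dg.
  by rewrite (ltW s0) (le_trans (ltW st)).
- apply: continuous_in_subspaceT => s; rewrite inE /= in_itv /= => /andP[s0 st].
  apply: differentiable_continuous; apply/derivable1_diffP.
  by have [] := dg s; rewrite ?s0 ?(le_trans st).
- rewrite scale0r addr0 subr0 mulrC => E; exists s => //.
  by move: sI; rewrite in_itv /= => /andP[-> st]; exact: le_trans st t1.
Qed.

(** Two mean value steps: along the segment from [z] to [z + w], which yields a parameter [c], then
    for each partial derivative between [z] and [z + c *: w]. The factor [c <= 1] is dropped. *)
Lemma taylor2_le f z w K :
  (forall s, 0 <= s <= 1 -> differentiable f (z + s *: w)) ->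
  (forall j s, 0 <= s <= 1 -> differentiable (partial j f) (z + s *: w)) ->
  (forall i j s, 0 <= s <= 1 -> `|partial i (partial j f) (z + s *: w)| <= K) ->
  `|f (z + w) - f z - \sum_j w 0 j * partial j f z| <=
    n%:R * (`|w| * (n%:R * (`|w| * K))).
Proof.
move=> df dp pK; have [|c c01] := @mvt_line f z w 1 _ df.
  by rewrite ler01 lexx.
rewrite scale1r mul1r => ->; rewrite derive_partial; last exact: df.
rewrite -sumrB; under eq_bigr do rewrite -mulrBr.
apply: le_norm_sum_coord => j.
have [s s01 ->] := @mvt_line _ z w c c01 (dp j).
rewrite derive_partial; last exact: dp.
have /andP[c0 c1] := c01; rewrite normrM (ger0_norm c0).
apply: le_trans (ler_piMl _ c1) _ => //.
by apply: le_norm_sum_coord => i; exact: pK.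
Qed.

End Hadamard.

(** * Smoothness of the Hadamard integrals and Hadamard's lemma *)

Section HadamardLemma.
Context {R : realType} {n : nat}.
Notation rV := 'rV[R]_n.
Implicit Types (D : set rV) (f : rV -> R) (a x y z w : rV) (t s r : R).

(* The power of [t] makes the family stable under differentiation:
   ['D_v (hadamard_int a m f) = hadamard_int a m.+1 ('D_v f)]. *)
Definition hadamard_int a m f x : R :=
  integral01 (fun t => t ^+ m * f (a + t *: (x - a))).

Lemma le_norm_line a x t r : 0 <= t <= 1 -> `|x - a| <= r ->
  `|a + t *: (x - a) - a| <= r.
Proof.
move=> /andP[t0 t1] xr; rewrite addrAC subrr add0r normrZ ger0_norm //.
by apply: le_trans xr; exact: ler_piMl.
Qed.

Lemma hadamard_int_continuous D a r m f x : smooth_on D f ->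
  (forall z, `|z - a| <= r -> D z) -> `|x - a| <= r ->
  continuous01 (fun t => t ^+ m * f (a + t *: (x - a))).
Proof.
move=> sf BD xr t t01.
apply: (@continuousM _ _ (fun t => t ^+ m) (fun t => f (a + t *: (x - a)))).
  exact: exprn_continuous.
apply: differentiable_continuous; apply/derivable1_diffP.
have df : differentiable f (a + t *: (x - a)).
  by apply: smooth_on_differentiable sf _; apply: BD; exact: le_norm_line.
by have [] := is_derive_line df.
Qed.

(** Differentiation under the integral sign: the Taylor remainder of the integrand is quadratic in
    [y - x] with a constant independent of [t], because the second partials are bounded on the
    compact closed ball. *)
Lemma hadamard_int_derive D a r m f x : 0 < r -> smooth_on D f ->
  (forall z, `|z - a| <= r -> D z) -> `|x - a| < r ->
  differentiable (hadamard_int a m f) x /\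
  forall v, 'D_v (hadamard_int a m f) x =
    comb_rV (fun j => hadamard_int a m.+1 (partial j f) x) v.
Proof.
move=> r0 sf BD xr.
have sp j := smooth_on_partial j sf.
have spp i j := smooth_on_partial i (sp j).
have /choice[K0 K0P] : forall ij : 'I_n * 'I_n, exists K, forall z,
    `|z - a| <= r -> `|partial ij.1 (partial ij.2 f) z| <= K.
  move=> ij; apply: le_norm_bounded r0 BD _ => z Dz.
  exact: smooth_on_continuous (spp _ _) Dz.
(* One bound for all second partials; starting the maximum at 0 gives [0 <= K] even over an empty
   index set. *)
set K := \big[Num.max/0]_ij K0 ij.
have KP i j z : `|z - a| <= r -> `|partial i (partial j f) z| <= K.
  by move=> /(K0P (i, j)) /le_trans; apply; exact: le_bigmax.
have K_ge0 : 0 <= K by exact: bigmax_ge_id.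
apply: (@quadratic_differentiable _ _ _ _ _ _ (n%:R * (n%:R * K))).
  exact: comb_rV_continuous.
have : \forall y \near x, `|y - a| < r.
  by apply: open_nbhs_nbhs; split => //; exact: open_lt_norm.
apply: filterS => y yr; have [xr' yr'] := (ltW xr, ltW yr).
have cf z := @hadamard_int_continuous D a r m f z sf BD.
have cp j : continuous01 (fun t => t ^+ m.+1 * partial j f (a + t *: (x - a))).
  exact: hadamard_int_continuous (sp j) BD xr'.
have cwp j : continuous01
    (fun t => (y - x) 0 j * (t ^+ m.+1 * partial j f (a + t *: (x - a)))).
  exact: continuous01Z.
rewrite /= /comb_rV /hadamard_int; under eq_bigr do rewrite -(integral01Z _ (cp _)).
rewrite -(integral01_sum cwp) -(integral01B (cf y yr') (cf x xr')).
rewrite -integral01B; last 2 first.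
- exact: continuous01B (cf y yr') (cf x xr').
- exact: continuous01_sum.
apply: integral01_norm_le => [t t01|t /[dup] t01 /andP[t0 t1]].
  exact: continuous01B (continuous01B (cf y yr') (cf x xr'))
    (continuous01_sum cwp) t t01.
(* At [y] the function [f] is evaluated at [z + w]. The segment from [z] to [z + w] stays in the
   closed ball by convexity, and the entries of [w] supply the extra power of [t]. *)
set z := a + t *: (x - a); set w := t *: (y - x).
have zw : a + t *: (y - a) = z + w.
  by apply/rowP => j; rewrite !mxE; ring.
have zwr s : 0 <= s <= 1 -> `|z + s *: w - a| <= r.
  move=> /andP[s0 s1].
  have -> : z + s *: w - a = t *: ((1 - s) *: (x - a) + s *: (y - a)).
    by apply/rowP => j; rewrite !mxE; ring.
  have s1' : 0 <= 1 - s by rewrite subr_ge0.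
  rewrite normrZ ger0_norm //; apply: le_trans (ler_piMl _ t1) _ => //.
  apply: le_trans (ler_normD _ _) _; rewrite !normrZ !ger0_norm //.
  have -> : r = (1 - s) * r + s * r by ring.
  by rewrite lerD // ler_wpM2l.
have -> : t ^+ m * f (a + t *: (y - a)) - t ^+ m * f z -
    \sum_j (y - x) 0 j * (t ^+ m.+1 * partial j f z) =
    t ^+ m * (f (z + w) - f z - \sum_j w 0 j * partial j f z).
  rewrite zw !mulrBr mulr_sumr; congr (_ - _); apply: eq_bigr => j _.
  have -> : w 0 j = t * (y - x) 0 j by rewrite mxE.
  by rewrite exprS; ring.
have wle : `|w| <= `|y - x| by rewrite normrZ ger0_norm // ler_piMl.
rewrite normrM ger0_norm ?exprn_ge0 //.
apply: le_trans (ler_piMl _ (exprn_ile1 _ t0 t1)) _ => //.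
apply: le_trans (@taylor2_le _ _ f z w K _ _ _) _.
- by move=> s /zwr/BD; exact: smooth_on_differentiable.
- by move=> j s /zwr/BD; exact: smooth_on_differentiable.
- by move=> i j s /zwr; exact: KP.
have -> : n%:R * (`|w| * (n%:R * (`|w| * K))) = n%:R * (n%:R * K) * `|w| ^+ 2.
  by ring.
by rewrite ler_wpM2l ?mulr_ge0 // ler_pXn2r ?nnegrE.
Qed.

Lemma hadamard_int_Ck D a r k m f : 0 < r -> smooth_on D f ->
  (forall z, `|z - a| <= r -> D z) ->
  Ck k [set x | `|x - a| < r] (hadamard_int a m f).
Proof.
move=> r0; elim: k m f => [|k IH] m f sf BD.
  move=> x xr; apply: differentiable_continuous.
  by have [] := hadamard_int_derive m r0 sf BD xr.
have H x := @hadamard_int_derive D a r m f x r0 sf BD.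
split=> [x /H[]//|v]; have oB := @open_lt_norm _ _ a r.
apply: Ck_ext (oB) (fun x xr => esym ((H x xr).2 v)) _.
apply: Ck_sum => // j; apply: CkZ => //.
exact: IH (smooth_on_partial j sf) BD.
Qed.

(** [G j x] is the integral of [partial j f] over the segment from [a] to [x]; the expansion is the
    fundamental theorem of calculus along that segment. *)
Lemma hadamard D a r f : 0 < r -> smooth_on D f ->
  (forall z, `|z - a| <= r -> D z) ->
  exists G : 'I_n -> rV -> R, [/\
    forall j, smooth_on [set x | `|x - a| < r] (G j),
    forall j, G j a = partial j f a &
    forall x, `|x - a| < r -> f x - f a = \sum_j (x - a) 0 j * G j x].
Proof.
move=> r0 sf BD; exists (fun j => hadamard_int a 0 (partial j f)); split.
- by move=> j k; exact: hadamard_int_Ck r0 (smooth_on_partial j sf) BD.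
- move=> j; rewrite /hadamard_int -[RHS]integral01_cst; congr integral01.
  by apply/funext => t; rewrite subrr scaler0 addr0 expr0 mul1r.
- move=> x /ltW xr.
  have cp j : continuous01 (fun t => t ^+ 0 * partial j f (a + t *: (x - a))).
    exact: hadamard_int_continuous (smooth_on_partial j sf) BD xr.
  have cwp j : continuous01
      (fun t => (x - a) 0 j * (t ^+ 0 * partial j f (a + t *: (x - a)))).
    exact: continuous01Z.
  under eq_bigr do rewrite /hadamard_int -(integral01Z _ (cp _)).
  rewrite -(integral01_sum cwp).
  have dl t : 0 <= t <= 1 -> is_derive t 1 (fun t => f (a + t *: (x - a)))
      (\sum_j (x - a) 0 j * (t ^+ 0 * partial j f (a + t *: (x - a)))).
    move=> t01; have df : differentiable f (a + t *: (x - a)).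
      by apply: smooth_on_differentiable sf _; apply: BD; exact: le_norm_line.
    have -> : \sum_j (x - a) 0 j * (t ^+ 0 * partial j f (a + t *: (x - a))) =
        'D_(x - a) f (a + t *: (x - a)).
      by rewrite derive_partial //; apply: eq_bigr => j _; rewrite expr0 mul1r.
    exact: is_derive_line.
  rewrite (integral01_derive (continuous01_sum cwp) dl).
  by rewrite scale1r scale0r addr0 [a + _]addrC subrK.
Qed.

End HadamardLemma.

(** * Bump functions, and extension by zero from a chart to the manifold *)

Section ExtensionByZero.
Context {R : realType} {n : nat}.
Notation rV := 'rV[R]_n.

Lemma open_setI_preimage (T U : topologicalType) (D : set T) (O : set U)
    (f : T -> U) : open D -> open O -> (forall x, D x -> continuous_at x f) ->
  open (D `&` f @^-1` O).
Proof.
move=> oD oO cf; rewrite openE => x [Dx Ox]; apply: filterI.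
  by apply: open_nbhs_nbhs.
by apply: cf => //; apply: open_nbhs_nbhs.
Qed.

Lemma smooth_on_sub (V : normedModType R) (D E : set V) (f : V -> R) :
  E `<=` D -> smooth_on D f -> smooth_on E f.
Proof. by move=> ED sf k; exact: Ck_sub ED (sf k). Qed.

Lemma smooth_on_mul (V : normedModType R) (D : set V) (f h : V -> R) : open D ->
  smooth_on D f -> smooth_on D h -> smooth_on D (fun x => f x * h x).
Proof. by move=> oD sf sh k; exact: Ck_mul. Qed.

(** The norm on row vectors is the sup norm, so its balls are cubes and a product of one-variable
    bumps is adapted to them. *)
Definition box_bump (a : rV) (r : R) (x : rV) : R :=
  \prod_j flatf 0 (r ^+ 2 - (x 0 j - a 0 j) ^+ 2).

Lemma box_bump_smooth a r : smooth_on setT (box_bump a r).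
Proof.
move=> k; have oT : open [set: rV] by exact: openT.
apply: (Ck_prod oT) => j.
apply: (@Ck_comp1 _ _ _ _ setT (fun x : rV => r ^+ 2 - (x 0 j - a 0 j) ^+ 2)) => //.
  have sx : Ck k setT (fun x : rV => x 0 j - a 0 j).
    apply: (CkB oT); first exact: Ck_rV_coord.
    exact: (@Ck_cst _ _ R).
  apply: (CkB oT); first exact: (@Ck_cst _ _ R).
  exact: (Ck_mul oT sx sx).
exact: Ck_flatf openT.
Qed.

Lemma box_bump_gt0 a r : 0 < r -> 0 < box_bump a r a.
Proof.
by move=> r0; apply: prodr_gt0 => j _; rewrite flatf0_gt0 subrr expr0n subr0 exprn_gt0.
Qed.

Lemma box_bump_eq0 a r x : 0 < r -> ~ `|x - a| <= r -> box_bump a r x = 0.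
Proof.
move=> r0 xr; apply/eqP/negPn/negP => /prodf_neq0 bx; apply: xr.
rewrite [leLHS]mx_normrE; apply: bigmax_le => [|[i j] _]; first exact: ltW.
rewrite ord1 !mxE /=; have := bx j isT.
rewrite neq_lt ltNge flatf_ge0 /= flatf0_gt0 subr_gt0 => xa.
by rewrite -ler_sqr ?nnegrE ?(ltW r0) // real_normK ?num_real // ltW.
Qed.

Variable M : manifold R n.

Definition ext0 (c : chart R n M) (h : rV -> R) (q : M) : R :=
  if q \in dom c then h (Defs.coord c q) else 0.

(** Two cases cover [M]. On the image of [D], compose [h] with the transition map. Elsewhere the
    function vanishes near the point, since the image of [K] is compact, hence closed in the
    Hausdorff space [M]. *)
Lemma ext0_smooth (c : chart R n M) (h : rV -> R) (D K : set rV) :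
  atlas c -> open D -> D `<=` img c -> compact K -> K `<=` D ->
  smooth_on D h -> (forall x, ~ K x -> h x = 0) -> smooth (ext0 c h).
Proof.
move=> ac oD Dc cK KD sh h0 c' ac' k; apply/Ck_pointwise => x c'x.
have [[z Dz zx]|xD] := pselect ((param c @` D) (param c' x)).
- set phi := Defs.coord c \o param c'.
  pose U1 := img c' `&` param c' @^-1` dom c.
  have oU1 : open U1.
    by apply: open_setI_preimage => [||y /param_continuous //];
      [exact: img_open|exact: dom_open].
  pose U := U1 `&` phi @^-1` D.
  have oU : open U.
    apply: open_setI_preimage => // y [c'y cy].
    apply: continuous_comp; first exact: param_continuous.
    exact: Defs.coord_continuous.
  have Ux : U x.
    split; first by split => //=; rewrite -zx; apply: param_dom; exact: Dc.
    by rewrite /phi /= -zx paramK //; exact: Dc.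
  have sphi : Ck k U phi.
    apply: Ck_sub (atlas_compatible ac' ac k) => y [[c'y cy] _].
    exists (param c' y); last by rewrite paramK.
    by split=> //; exact: param_dom.
  have := @Ck_comp_rV _ _ _ k U D phi h oU (fun y Uy => Uy.2) sphi (sh k).
  move=> /(Ck_near oU Ux); apply.
  apply: filterS (open_nbhs_nbhs (conj oU Ux)) => y [[c'y cy] _].
  by rewrite /ext0 /= mem_set.
- pose K' := param c @` K.
  have clK' : closed K'.
    apply: compact_closed; first exact: mspace_hausdorff.
    apply: continuous_compact cK.
    apply: continuous_in_subspaceT => y; rewrite inE => Ky.
    by apply: param_continuous; exact/Dc/KD.
  have oV : open (img c' `&` param c' @^-1` (~` K')).
    apply: open_setI_preimage; first exact: img_open.
      exact: closed_openC.
    by move=> y /param_continuous.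
  apply: (@Ck_near _ _ _ k setT (fun=> 0 : R) _ x openT I).
    exact: (@Ck_cst _ _ R).
  have Vx : (img c' `&` param c' @^-1` (~` K')) x.
    by split => //= -[z Kz zx]; apply: xD; exists z => //; exact: KD.
  apply: filterS (open_nbhs_nbhs (conj oV Vx)) => y [c'y K'y].
  rewrite /= /ext0; case: ifPn => // /set_mem cy; rewrite h0 // => Ky.
  by apply: K'y; exists (Defs.coord c (param c' y)) => //; rewrite coordK.
Qed.

End ExtensionByZero.

(** * Coordinate vector fields cut off to global fields *)

Section CoordinateFields.
Context {R : realType} {n : nat} {M : manifold R n}.
Notation rV := 'rV[R]_n.
Notation F := (smooth_fun M).

Lemma partial_lin j (f h : rV -> R) a x :
  differentiable f x -> differentiable h x ->
  partial j (fun y => a * f y + h y) x = a * partial j f x + partial j h x.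
Proof.
move=> df dh; rewrite /partial (@deriveD _ _ _ (a \*: f) h); last 2 first.
- by apply: diff_derivable; exact: differentiableZ.
- exact: diff_derivable.
by rewrite deriveZ //; exact: diff_derivable.
Qed.

Lemma partialM j (f h : rV -> R) x :
  differentiable f x -> differentiable h x ->
  partial j (fun y => f y * h y) x = f x * partial j h x + h x * partial j f x.
Proof.
move=> df dh; rewrite /partial (@deriveM _ _ f h) //; exact: diff_derivable.
Qed.

Context (c : chart R n M) (K : set rV) (b : rV -> R).
Context (ac : atlas c) (cK : compact K) (KD : K `<=` img c).
Context (sb : smooth_on setT b) (b0 : forall x, ~ K x -> b x = 0).

Lemma chart_differentiable (f : F) x : img c x -> differentiable (f \o param c) x.
Proof.
exact: smooth_on_differentiable (smooth_val_smooth f ac).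
Qed.

(** The factor [b], a bump supported in the chart, is what lets the coordinate derivation extend by
    zero to a smooth field on all of [M]. *)
Definition coord_vector (j : 'I_n) (q : M) (f : F) : R :=
  ext0 c (fun x => b x * partial j (f \o param c) x) q.

Lemma coord_vector_derivation j q : derivation_at q (coord_vector j q).
Proof.
split=> [a f h|f h]; rewrite /coord_vector /ext0;
  (case: ifPn => [/set_mem cq|_]; last by ring); have cx := coord_img cq.
- have -> : (a *: f + h : F) \o param c =
      (fun y => a * (f \o param c) y + (h \o param c) y) by [].
  by rewrite partial_lin; [ring|exact: chart_differentiable..].
- have -> : (f * h : F) \o param c =
      (fun y => (f \o param c) y * (h \o param c) y) by [].
  rewrite partialM; [|exact: chart_differentiable..].
  by rewrite /= coordK //; ring.
Qed.

Lemma coord_vector_smooth j (f : F) : smooth (fun q => coord_vector j q f).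
Proof.
apply: (@ext0_smooth _ _ _ c _ (img c) K) => //; first exact: img_open.
- apply: smooth_on_mul; first exact: img_open.
    exact: smooth_on_sub sb.
  exact: smooth_on_partial (smooth_val_smooth f ac).
- by move=> x /b0 ->; rewrite mul0r.
Qed.

Definition coord_field (j : 'I_n) : vfield M :=
  @VField _ _ _ (fun q => mk_tangent (coord_vector_derivation j q))
    (coord_vector_smooth j).

End CoordinateFields.

(** * Coordinate vectors span the derivations at a point *)

Section TangentBasis.
Context {R : realType} {n : nat} {M : manifold R n}.
Notation rV := 'rV[R]_n.
Notation F := (smooth_fun M).

Lemma smooth_fun_sumE I (s : seq I) (f : I -> F) (q : M) :
  (\sum_(i <- s) f i) q = \sum_(i <- s) f i q.
Proof. by elim/big_rec2: _ => // i x y _ <-. Qed.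

Lemma smooth_funME (f h : F) (q : M) : (f * h) q = f q * h q.
Proof. by []. Qed.

Lemma smooth_funBE (f h : F) (q : M) : (f - h) q = f q - h q.
Proof. by []. Qed.

Lemma tangent_sumE p I (s : seq I) (v : I -> tangent p) (f : F) :
  (\sum_(i <- s) v i) f = \sum_(i <- s) v i f.
Proof. by elim/big_rec2: _ => // i x y _ <-. Qed.

Lemma tangentD p (v : tangent (M := M) p) f h : v (f + h) = v f + v h.
Proof. by have := tangent_lin v 1 f h; rewrite scale1r mul1r. Qed.

Lemma tangent0 p (v : tangent (M := M) p) : v 0 = 0.
Proof. by apply: (addrI (v 0)); rewrite -tangentD !addr0. Qed.

Lemma tangentZ p (v : tangent (M := M) p) a f : v (a *: f) = a * v f.
Proof. by rewrite -[a *: f]addr0 tangent_lin tangent0 addr0. Qed.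

Lemma tangent_sum p (v : tangent p) I (s : seq I) (f : I -> F) :
  v (\sum_(i <- s) f i) = \sum_(i <- s) v (f i).
Proof.
by apply: (big_morph v) => [f1 f2|]; [exact: tangentD|exact: tangent0].
Qed.

Lemma tangent1 p (v : tangent (M := M) p) : v 1 = 0.
Proof.
have : v (1 * 1) = v 1 * 1 + 1 * v 1 by exact: tangentM.
by rewrite mulr1 mulr1 mul1r => /(congr1 (fun z => z - v 1)); rewrite subrr addrK.
Qed.

Lemma partial_coord (i j : 'I_n) (a x : rV) :
  partial i (fun y => y 0 j - a 0 j) x = (i == j)%:R.
Proof.
have cl := @rV_coord_continuous R n j.
have dl := linear_differentiable x cl.
rewrite /partial (@deriveB _ _ _ (@rV_coord R n j) (cst (a 0 j))) //.
  rewrite derive_cst subr0 deriveE // diff_lin //= /rV_coord mxE eqxx /=.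
  by rewrite eq_sym.
exact: diff_derivable.
Qed.

(* [xi j] is the j-th chart coordinate and [E i] the i-th coordinate field,
   both multiplied by a bump function. By Hadamard's lemma
   [B^2 (f - f p) = \sum_j xi j * G j] with [G j] smooth, so a derivation at [p]
   is determined by its values on the [xi j]. *)
Lemma tangent_basis (p : M) :
  exists (E : 'I_n -> vfield M) (xi : 'I_n -> F) (beta : R),
  [/\ beta != 0, forall i j, E i p (xi j) = beta *+ (i == j) &
      forall v : tangent p, v = \sum_j (v (xi j) / beta) *: E j p].
Proof.
have [c ac cp] := atlas_cover p.
set a := Defs.coord c p; have ca : img c a := coord_img cp.
have pa : param c a = p by exact: coordK.
have /nbhs_ballP[e /= e0 eB] := open_nbhs_nbhs (conj (@img_open _ _ _ c) ca).
(* Nested radii [r < rho < e]: the bump lives in the ball of radius [r], Hadamard's expansion holds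
   in the open ball of radius [rho], and the closed ball of radius [rho] lies in the chart image. *)
pose rho := e / 2; pose r := rho / 2.
have rho0 : 0 < rho by rewrite divr_gt0.
have r0 : 0 < r by rewrite divr_gt0.
have r_rho : r < rho by rewrite ltr_pdivrMr // ltr_pMr // ltr1n.
have BD x : `|x - a| <= rho -> img c x.
  move=> xa; apply: eB; rewrite -ball_normE /= distrC (le_lt_trans xa) //.
  by rewrite ltr_pdivrMr // ltr_pMr // ltr1n.
pose b := box_bump a r.
have sb : smooth_on setT b := box_bump_smooth a r.
have b0 x : ~ `|x - a| <= r -> b x = 0 by exact: box_bump_eq0.
have ba0 : b a != 0 by rewrite gt_eqF //; exact: box_bump_gt0.
have cK := @compact_le_norm R n a r.
have KD : [set x | `|x - a| <= r] `<=` img c.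
  by move=> x /= xr; apply: BD; exact: le_trans xr (ltW r_rho).
have KB : [set x | `|x - a| <= r] `<=` [set x | `|x - a| < rho].
  by move=> x /= xr; exact: le_lt_trans xr r_rho.
have BI : [set x | `|x - a| < rho] `<=` img c by move=> x /= /ltW /BD.
have oI := @img_open _ _ _ c.
have sB : smooth (ext0 c b).
  exact: (ext0_smooth ac oI _ cK KD (smooth_on_sub (@subsetT _ _) sb) b0).
pose B : F := mk_smooth sB.
have scoord j : smooth_on (img c) (fun x : rV => x 0 j - a 0 j).
  move=> k; apply: (CkB oI); [exact: Ck_rV_coord|exact: (@Ck_cst _ _ R)].
have sxi j : smooth (ext0 c (fun x => b x * (x 0 j - a 0 j))).
  apply: (ext0_smooth ac oI _ cK KD) => //.
    exact: smooth_on_mul oI (smooth_on_sub (@subsetT _ _) sb) (scoord j).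
  by move=> x /b0 ->; rewrite mul0r.
pose xi j : F := mk_smooth (sxi j).
pose E j := coord_field ac cK KD sb b0 j.
have EE j f : E j p f = b a * partial j (f \o param c) a.
  by rewrite /= /coord_vector /ext0 mem_set.
have dI (h : rV -> R) x : smooth_on (img c) h -> img c x -> differentiable h x.
  by move=> sh cx; exact: smooth_on_differentiable sh cx.
have db : differentiable b a by exact: smooth_on_differentiable sb I.
(* One factor [b a] comes from [E i], the other from [xi j]; the term with the derivative of [b]
   carries the factor [x 0 j - a 0 j], zero at [a]. *)
exists E, xi, (b a ^+ 2); split; first by rewrite expf_neq0.
  move=> i j; rewrite EE.
  have -> : partial i (xi j \o param c) a =
      partial i (fun x => b x * (x 0 j - a 0 j)) a.
    apply: near_eq_derive; apply: filterS (open_nbhs_nbhs (conj oI ca)) => x cx.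
    by rewrite /= /ext0 mem_set ?paramK //; exact: param_dom.
  rewrite partialM // ?partial_coord ?subrr ?mul0r ?addr0; last exact: dI.
  by rewrite mulrA -expr2 mulr_natr.
move=> v; apply: tangentP => f; rewrite tangent_sumE.
have sf : smooth_on (img c) (f \o param c) := smooth_val_smooth f ac.
have [G [sG Ga GE]] := hadamard rho0 sf BD.
have sGG j : smooth (ext0 c (fun x => b x * G j x)).
  apply: (ext0_smooth ac (@open_lt_norm _ _ a rho) BI cK KB).
    exact: smooth_on_mul (@open_lt_norm _ _ _ _)
      (smooth_on_sub (@subsetT _ _) sb) (sG j).
  by move=> x /b0 ->; rewrite mul0r.
pose GG j : F := mk_smooth (sGG j).
have key : B * B * (f - f p *: (1 : F) : F) = \sum_j xi j * GG j.
  apply: smooth_funP => q; rewrite smooth_fun_sumE.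
  under eq_bigr do rewrite smooth_funME.
  have -> : (B * B * (f - f p *: (1 : F) : F)) q = B q * B q * (f q - f p * 1) by [].
  rewrite mulr1 /= /ext0; case: ifPn => [/set_mem cq|_]; last first.
    by rewrite !mul0r big1 // => j _; rewrite mul0r.
  set x := Defs.coord c q.
  have [xr|xr] := pselect (`|x - a| < rho); last first.
    have bx : b x = 0.
      by apply: (b0) => xr'; apply: xr; exact: le_lt_trans xr' r_rho.
    by rewrite bx !mul0r big1 // => j _; rewrite !mul0r.
  have -> : f q - f p = \sum_j (x - a) 0 j * G j x.
    by rewrite -GE //= coordK // pa.
  by rewrite mulr_sumr; apply: eq_bigr => j _; rewrite !mxE; ring.
(* By the Leibniz rule at [p], where [f - f p] and every [xi j] vanish, this reads
   [b(a)^2 v(f) = \sum_j v(xi j) GG_j(p)], and [GG_j(p)] equals [E j p f]. *)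
have /(congr1 v) := key; rewrite tangentM tangent_sum.
have -> : (f - f p *: (1 : F) : F) p = 0.
  by have -> : (f - f p *: (1 : F) : F) p = f p - f p * 1 by []; rewrite mulr1 subrr.
have -> : v (f - f p *: (1 : F) : F) = v f.
  by rewrite -scaleN1r tangentD !tangentZ tangent1 !mulr0 addr0.
have Bp : B p = b a by rewrite /= /ext0 mem_set.
have -> : (B * B) p = b a * b a by rewrite -Bp.
rewrite mulr0 add0r => H.
have b20 : b a ^+ 2 != 0 by rewrite expf_neq0.
apply: (mulfI b20); rewrite [LHS]H mulr_sumr; apply: eq_bigr => j _.
have -> : ((v (xi j) / b a ^+ 2) *: E j p : tangent p) f =
  v (xi j) / b a ^+ 2 * E j p f by [].
rewrite tangentM EE.
have -> : xi j p = 0 by rewrite /= /ext0 mem_set // -/a subrr mulr0.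
have -> : GG j p = b a * partial j (f \o param c) a.
  by rewrite /= /ext0 mem_set // -/a Ga.
by rewrite mul0r addr0 [RHS]mulrA [b a ^+ 2 * _]mulrC divfK.
Qed.

End TangentBasis.

(** * Smooth normalization of a function that is nonzero at a point *)

Section OrthonormalFrames.
Context {R : realType} {n : nat} {M : manifold R n}.
Notation F := (smooth_fun M).

Lemma smooth_continuous (f : F) : continuous f.
Proof.
move=> q; have [c ac cq] := atlas_cover q.
have cf : continuous_at (Defs.coord c q) (f \o param c).
  exact: smooth_on_continuous (smooth_val_smooth f ac) (coord_img cq).
have fq : ((f \o param c) \o Defs.coord c) x @[x --> q] --> f q.
  have -> : f q = ((f \o param c) \o Defs.coord c) q by rewrite /= coordK.
  exact: continuous_comp (Defs.coord_continuous cq) cf.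
apply: cvg_trans fq; apply: near_eq_cvg.
apply: filterS (open_nbhs_nbhs (conj (@dom_open _ _ _ c) cq)) => q' cq'.
by rewrite /= coordK.
Qed.

Lemma smooth_comp1 (f : F) (E : set R) (h : R -> R) :
  smooth_on E h -> (forall q, E (f q)) -> smooth (fun q => h (f q)).
Proof.
move=> sh Ef c ac k.
exact: (@Ck_comp1 _ _ _ _ E (f \o param c) h (@img_open _ _ _ c)
  (fun x _ => Ef _) (smooth_val_smooth f ac k) (sh k)).
Qed.

(* [psi = chi^(-1/4)], where [chi] is positive everywhere and equal to [phi^2]
   near [p]. *)
Lemma normalizer (phi : F) (p : M) : phi p != 0 ->
  exists (psi : F) (s : R) (U : set M), [/\ open_nbhs p U, s = 1 \/ s = -1 &
    forall q, U q -> psi q ^+ 2 * phi q = s].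
Proof.
(* On [U] below, [phi q * phi p > phi(p)^2 / 2] forces [phi(q)^2 > phi(p)^2 / 4 = c], so the flat
   term of [chi] vanishes there; where [phi^2 < c] that term is positive. *)
move=> phi0; pose c := phi p ^+ 2 / 4.
have c0 : 0 < c by rewrite divr_gt0 // exprn_even_gt0.
have sflat : smooth (fun q => flatf 0 ((c *: (1 : F) - phi * phi : F) q)).
  by apply: (@smooth_comp1 _ setT) => // k; exact: Ck_flatf openT.
pose chi : F := phi * phi + mk_smooth sflat.
have chiE q : chi q = phi q ^+ 2 + flatf 0 (c * 1 - phi q ^+ 2) by [].
have chi0 q : 0 < chi q.
  rewrite chiE mulr1; have := flatf_ge0 0 (c - phi q ^+ 2).
  have := sqr_ge0 (phi q); have := flatf0_gt0 (c - phi q ^+ 2).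
  case: (ltP 0 (c - phi q ^+ 2)) => [cq|cq] H; lra.
have spsi : smooth (fun q => chi q `^ (- 4^-1)).
  apply: (@smooth_comp1 chi [set x : R | 0 < x] (fun x => x `^ (- 4^-1))) => //.
  by move=> k; exact: Ck_powR.
pose U : set M := [set q | phi p ^+ 2 / 2 < phi q * phi p].
exists (mk_smooth spsi), (Num.sg (phi p)), U; split.
- split; last by rewrite /U /=; nra.
  have cphi : continuous (fun q => phi q * phi p).
    move=> q; apply: (@continuousM _ _ phi (fun=> phi p)).
      exact: smooth_continuous.
    exact: cst_continuous.
  by apply: (open_comp _ (@open_gt _ (phi p ^+ 2 / 2))) => q _; exact: cphi.
- have [h|h|h] := ltrgt0P (phi p); last by rewrite h eqxx in phi0.
    by left; exact: gtr0_sg.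
  by right; exact: ltr0_sg.
move=> q Uq.
have q0 : c < phi q ^+ 2.
  rewrite /c; move: Uq; rewrite /U /=; nra.
have -> : mk_smooth spsi q = chi q `^ (- 4^-1) by [].
have -> : chi q = phi q ^+ 2.
  rewrite chiE /flatf mulr1 subr_gt0 ltNge (ltW q0) /= addr0 //.
have phiq0 : phi q != 0 by apply/eqP => E; move: q0; rewrite E expr0n /= ltNge ltW.
(* [psi^2 = (phi^2)^(-1/2) = 1/|phi|], so the product is the sign of [phi q], which on [U] is that
   of [phi p]. *)
rewrite expr2 -powRD; last by rewrite expf_neq0 // implybT.
have -> : - 4^-1 - 4^-1 = - 2^-1 :> R by field.
rewrite powRN powR12_sqrt ?sqr_ge0 // sqrtr_sqr.
rewrite {2}(numEsg (phi q)) mulrCA mulVf ?normr_eq0 // mulr1.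
have pq : 0 < phi q * phi p.
  by apply: le_lt_trans Uq; rewrite divr_ge0 ?sqr_ge0.
have := gtr0_sg pq; rewrite sgrM => /(congr1 (fun z => z * Num.sg (phi p))).
by rewrite -mulrA -expr2 sqr_sg phi0 mulr1 mul1r.
Qed.

End OrthonormalFrames.

Lemma pm1_sqr (R : realType) (x : R) : x = 1 \/ x = -1 -> x * x = 1.
Proof. by case=> ->; rewrite ?mulr1 // mulrNN mulr1. Qed.

(** * Gram-Schmidt for an indefinite metric, and existence of local frames *)

Section GramSchmidt.
Context {R : realType} {n : nat} {M : manifold R n} (g : semi_metric M).
Notation F := (smooth_fun M).
Notation gp := (metric_at g).

Lemma metric_atDl p (u v w : tangent p) : gp (u + v) w = gp u w + gp v w.
Proof. by have := metric_linear g 1 u v w; rewrite scale1r mul1r. Qed.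

Lemma metric_at0l p (w : tangent p) : gp 0 w = 0.
Proof. by apply: (addrI (gp 0 w)); rewrite -metric_atDl !addr0. Qed.

Lemma metric_atZl p a (u w : tangent p) : gp (a *: u) w = a * gp u w.
Proof. by rewrite -[a *: u]addr0 metric_linear metric_at0l addr0. Qed.

Lemma metric_atDr p (u v w : tangent p) : gp w (u + v) = gp w u + gp w v.
Proof. by rewrite !(Defs.metric_sym g w) metric_atDl. Qed.

Lemma metric_atZr p a (u w : tangent p) : gp w (a *: u) = a * gp w u.
Proof. by rewrite !(Defs.metric_sym g w) metric_atZl. Qed.

Lemma metric_at_suml p I (s : seq I) (u : I -> tangent p) w :
  gp (\sum_(i <- s) u i) w = \sum_(i <- s) gp (u i) w.
Proof.
by apply: (big_morph (fun x => gp x w)) => [x y|];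
  [exact: metric_atDl|exact: metric_at0l].
Qed.

Lemma metric_at_sumr p I (s : seq I) (u : I -> tangent p) w :
  gp w (\sum_(i <- s) u i) = \sum_(i <- s) gp w (u i).
Proof.
by rewrite Defs.metric_sym metric_at_suml; apply: eq_bigr => i _; exact: Defs.metric_sym.
Qed.

Lemma vfield_sumE I (s : seq I) (X : I -> vfield M) (q : M) :
  (\sum_(i <- s) X i) q = \sum_(i <- s) X i q.
Proof. by elim/big_rec2: _ => // i x y _ <-. Qed.

(** The induction invariant of Gram-Schmidt; at [k = n] it amounts to [orthonormal_frame]. *)
Definition orthonormal_family k (U : set M) (e : 'I_k -> vfield M)
    (eps : 'I_k -> R) : Prop :=
  (forall i, eps i = 1 \/ eps i = -1) /\
  (forall q, U q -> forall i j, gp (e i q) (e j q) = eps i *+ (i == j)).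

Section Projection.
Context (p : M) (k : nat) (U : set M) (e : 'I_k -> vfield M) (eps : 'I_k -> R).
Context (Up : U p) (one : orthonormal_family U e eps).
Implicit Types (X Y : vfield M) (q : M).

(** A global field, but the orthogonal projection onto the span of the [e i] only over [U]. The
    coefficient [eps i] is its own inverse. *)
Definition orthonormal_proj (X : vfield M) : vfield M :=
  \sum_i (eps i *: metric g X (e i)) *: e i.

Lemma orthonormal_projE X q :
  orthonormal_proj X q = \sum_i (eps i * gp (X q) (e i q)) *: e i q.
Proof. by rewrite /orthonormal_proj vfield_sumE. Qed.

Lemma orthonormal_proj_metric X q j : U q ->
  gp (orthonormal_proj X q) (e j q) = gp (X q) (e j q).
Proof.
move=> Uq; rewrite orthonormal_projE metric_at_suml (bigD1 j) //= big1.
  by rewrite addr0 metric_atZl one.2 // eqxx mulr1n mulrAC pm1_sqr ?mul1r //; exact: one.1.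
by move=> i ij; rewrite metric_atZl one.2 // (negbTE ij) mulr0n mulr0.
Qed.

Definition orthonormal_rest (X : vfield M) : vfield M := X - orthonormal_proj X.

Lemma orthonormal_restE X q :
  X q = orthonormal_rest X q + orthonormal_proj X q.
Proof.
have -> : orthonormal_rest X q = X q - orthonormal_proj X q by [].
by rewrite subrK.
Qed.

Lemma orthonormal_rest_metric X q j : U q ->
  gp (orthonormal_rest X q) (e j q) = 0.
Proof.
move=> Uq; have := congr1 (fun u : tangent q => gp u (e j q)) (orthonormal_restE X q).
rewrite metric_atDl orthonormal_proj_metric // => H.
by apply: (addIr (gp (X q) (e j q))); rewrite add0r.
Qed.

(* Otherwise each [orthonormal_rest (E j)] is orthogonal to all of [T_p M], so
   by nondegeneracy [T_p M] is spanned by [k < n] vectors. *)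
Lemma orthonormal_rest_nonisotropic : (k < n)%N ->
  exists X Y : vfield M,
    gp (orthonormal_rest X p) (orthonormal_rest Y p) != 0.
Proof.
move=> kn; apply: contrapT => iso0.
have iso X Y : gp (orthonormal_rest X p) (orthonormal_rest Y p) = 0.
  by apply/eqP/negPn/negP => H; apply: iso0; exists X, Y.
have [E [xi [beta [beta0 Exi Espan]]]] := tangent_basis p.
have rest0 X : orthonormal_rest X p = 0.
  apply: (metric_nondegenerate (s := g)) => v.
  rewrite (Espan v) metric_at_sumr big1 // => j _.
  rewrite metric_atZr (orthonormal_restE (E j)) metric_atDr iso add0r.
  rewrite orthonormal_projE metric_at_sumr big1 ?mulr0 // => i _.
  by rewrite metric_atZr orthonormal_rest_metric // mulr0.
(* [A] expresses each [E i p] through the [k] vectors [e j p], and [B] evaluates these on the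
   [xi j]. The product is [beta] times the identity, of rank [n], yet it factors through dimension
   [k < n]. *)
pose A : 'M[R]_(n, k) := \matrix_(i, j) (eps j * gp (E i p) (e j p)).
pose B : 'M[R]_(k, n) := \matrix_(i, j) e i p (xi j).
have AB : A *m B = beta%:M.
  apply/matrixP => i j; rewrite !mxE -Exi orthonormal_restE rest0 add0r.
  rewrite orthonormal_projE tangent_sumE; apply: eq_bigr => l _.
  by rewrite !mxE.
have : \rank (A *m B) = n by rewrite AB -scalemx1 mxrank_scale_nz ?mxrank1.
have := leq_trans (mxrankM_maxl A B) (rank_leq_col A) => H1 H2.
by move: H1; rewrite H2 leqNgt kn.
Qed.

(** Polarization: if [u] and [v] are null and [g(u, v)] is nonzero, then [u + v] has square
    [2 g(u, v)]. *)
Lemma orthonormal_rest_nonnull : (k < n)%N ->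
  exists X : vfield M, gp (orthonormal_rest X p) (orthonormal_rest X p) != 0.
Proof.
move=> /orthonormal_rest_nonisotropic[X [Y XY]].
have [X0|] := eqVneq (gp (orthonormal_rest X p) (orthonormal_rest X p)) 0;
  last by exists X.
have [Y0|] := eqVneq (gp (orthonormal_rest Y p) (orthonormal_rest Y p)) 0;
  last by exists Y.
exists (X + Y).
have -> : orthonormal_rest (X + Y) p =
    orthonormal_rest X p + orthonormal_rest Y p.
  apply: (addIr (orthonormal_proj (X + Y) p)); rewrite -orthonormal_restE.
  have -> : orthonormal_proj (X + Y) p = orthonormal_proj X p + orthonormal_proj Y p.
    rewrite !orthonormal_projE -big_split; apply: eq_bigr => i _ /=.
    by rewrite metric_atDl mulrDr scalerDl.
  by rewrite addrACA -!orthonormal_restE.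
move: XY X0 Y0; move: (orthonormal_rest X p) (orthonormal_rest Y p) => u v uv u0 v0.
rewrite metric_atDl !metric_atDr u0 v0 add0r addr0.
by rewrite [gp v u]Defs.metric_sym -mulr2n mulrn_eq0 negb_or uv.
Qed.

End Projection.

(** The added field is a non-null rest, rescaled by [normalizer] to square 1 or -1 on a smaller
    neighborhood and placed at the last index. *)
Lemma orthonormal_family_extend p k (U : set M) (e : 'I_k -> vfield M) eps :
  (k < n)%N -> open_nbhs p U -> orthonormal_family U e eps ->
  exists (U' : set M) (e' : 'I_k.+1 -> vfield M) (eps' : 'I_k.+1 -> R),
    open_nbhs p U' /\ orthonormal_family U' e' eps'.
Proof.
move=> kn [oU Up] one.
have [X] := orthonormal_rest_nonnull Up one kn; set Z := orthonormal_rest e eps X.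
rewrite (_ : gp _ _ = metric g Z Z p) // => /normalizer[psi [s [U' [[oU' U'p] s1 psiP]]]].
pose e' (i : 'I_k.+1) := oapp e (psi *: Z) (unlift ord_max i).
pose eps' (i : 'I_k.+1) := oapp eps s (unlift ord_max i).
have Ze j q : U q -> gp (Z q) (e j q) = 0 by exact: orthonormal_rest_metric.
exists (U `&` U'), e', eps'; split; first by split; [exact: openI|split].
split=> [i|q [Uq U'q] i j]; rewrite /eps' /e'.
  by case: unliftP => [i' _|_]; [exact: one.1|].
case: unliftP => [i' ->|->]; case: unliftP => [j' ->|->] /=.
- by rewrite one.2 // (inj_eq lift_inj).
- rewrite eq_sym (negbTE (neq_lift _ _)) mulr0n.
  by rewrite Defs.metric_sym metric_atZl Ze // mulr0.
- by rewrite (negbTE (neq_lift _ _)) mulr0n metric_atZl Ze // mulr0.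
- rewrite eqxx mulr1n metric_atZl metric_atZr -(psiP q U'q) expr2 -mulrA.
  by [].
Qed.

Lemma frame_near_exists p : frame_near g p !=set0.
Proof.
suff H k : (k <= n)%N -> exists (U : set M) (e : 'I_k -> vfield M) eps,
    open_nbhs p U /\ orthonormal_family U e eps.
  by have [U [e [eps [pU one]]]] := H n (leqnn n); exists (e, eps); exists U.
elim: k => [_|k IH kn].
  exists setT, (fun=> 0), (fun=> 0); split; first by split; [exact: openT|].
  by split=> [[]|q _ []].
have [U [e [eps [pU one]]]] := IH (ltnW kn).
exact: orthonormal_family_extend kn pU one.
Qed.

End GramSchmidt.

(** * Vector fields as operators on functions, and the Jacobi identity *)

Section VectorFieldCalculus.
Context {R : realType} {n : nat} {M : manifold R n}.
Notation F := (smooth_fun M).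
Implicit Types (X Y Z W : vfield M) (f h : F).

Lemma vactD X f h : vact X (f + h) = vact X f + vact X h.
Proof. by apply: smooth_funP => p; exact: tangentD. Qed.

Lemma vactN X f : vact X (- f) = - vact X f.
Proof.
by apply: smooth_funP => p; rewrite -scaleN1r /= tangentZ mulN1r.
Qed.

Lemma vact_bracket X Y f :
  vact (bracket X Y) f = vact X (vact Y f) - vact Y (vact X f).
Proof. by apply: smooth_funP. Qed.

(** The action on functions is faithful, so bracket identities become identities between commutators
    of operators. *)
Lemma vfield_vactP X Y : (forall f, vact X f = vact Y f) -> X = Y.
Proof.
move=> XY; apply: vfieldP => p; apply: tangentP => f.
exact: (congr1 (fun h : F => h p) (XY f)).
Qed.

Lemma vact_addl X Y f : vact (X + Y) f = vact X f + vact Y f.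
Proof. by apply: smooth_funP. Qed.

Lemma vact_oppl X f : vact (- X) f = - vact X f.
Proof. by apply: smooth_funP. Qed.

Lemma bracketC X Y : bracket X Y = - bracket Y X.
Proof.
by apply: vfield_vactP => f; rewrite vact_oppl !vact_bracket opprB.
Qed.

Lemma bracket_jacobi X Y Z :
  bracket X (bracket Y Z) =
    - bracket Y (bracket Z X) - bracket Z (bracket X Y).
Proof.
apply: vfield_vactP => f.
rewrite vact_addl !vact_oppl !vact_bracket !vactD !vactN; ring.
Qed.

End VectorFieldCalculus.

(** * Bilinearity of the metric over smooth functions *)

Section Metric.
Context {R : realType} {n : nat} {M : manifold R n} (g : semi_metric M).
Notation F := (smooth_fun M).
Notation m := (Defs.metric g).
Implicit Types (X Y Z W : vfield M) (f h : F).

Lemma metricC X Y : m X Y = m Y X.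
Proof. by apply: smooth_funP => p; exact: Defs.metric_sym. Qed.

Lemma metricDl X Y Z : m (X + Y) Z = m X Z + m Y Z.
Proof. by apply: smooth_funP => p; exact: metric_atDl. Qed.

Lemma metricZl f X Z : m (f *: X) Z = f * m X Z.
Proof. by apply: smooth_funP => p; exact: metric_atZl. Qed.

Lemma metricNl X Z : m (- X) Z = - m X Z.
Proof. by rewrite -scaleN1r metricZl mulN1r. Qed.

Lemma metricDr X Y Z : m Z (X + Y) = m Z X + m Z Y.
Proof. by rewrite !(metricC Z) metricDl. Qed.

Lemma metricZr f X Z : m Z (f *: X) = f * m Z X.
Proof. by rewrite !(metricC Z) metricZl. Qed.

Lemma metricNr X Z : m Z (- X) = - m Z X.
Proof. by rewrite !(metricC Z) metricNl. Qed.

Definition metricE := (metricDl, metricNl, metricZl, metricDr, metricNr, metricZr).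

End Metric.

(** * Symmetries of the Levi-Civita curvature *)

Section LeviCivita.
Context {R : realType} {n : nat} {M : manifold R n} (g : semi_metric M).
Context (D : vfield M -> vfield M -> vfield M) (lcD : is_levi_civita g D).
Notation F := (smooth_fun M).
Notation m := (Defs.metric g).
Implicit Types (X Y Z W V : vfield M) (f h : F).
Let cD : is_connection D := levi_civita_connection lcD.

Lemma connectionNr X Y : D X (- Y) = - D X Y.
Proof.
apply: (addrI (D X Y)); rewrite -(connectionDr cD) !subrr.
by apply: (addrI (D X 0)); rewrite -(connectionDr cD) !addr0.
Qed.

Lemma torsion_swap X Y : D Y X = D X Y - bracket X Y.
Proof. by rewrite -(levi_civita_torsion lcD) opprB addrC subrK. Qed.

Lemma vact_metric X Y Z : vact X (m Y Z) = m (D X Y) Z + m Y (D X Z).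
Proof. exact: levi_civita_metric lcD X Y Z. Qed.

Lemma curvature4_skewl D' X Y Z W : is_connection D' ->
  curvature4 g D' X Y Z W = - curvature4 g D' Y X Z W.
Proof.
move=> cD'; rewrite /curvature4 /curvature (bracketC X Y).
rewrite -[- bracket Y X]scaleN1r (connectionZl cD') !metricE; ring.
Qed.

(** Metric compatibility expands both sides of [[X, Y] g(Z, W) = X Y g(Z, W) - Y X g(Z, W)]; the
    mixed products of first derivatives cancel. *)
Lemma curvature4_skewr X Y Z W :
  curvature4 g D X Y Z W = - curvature4 g D X Y W Z.
Proof.
have := vact_bracket X Y (m Z W); rewrite !vact_metric !vactD !vact_metric => H.
rewrite /curvature4 /curvature !metricE.
rewrite (metricC _ (D X (D Y W))) (metricC _ (D Y (D X W))).
rewrite (metricC _ (D _ W) Z).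
have -> : m Z (D (bracket X Y) W) =
  m (D X (D Y Z)) W - m (D Y (D X Z)) W + m Z (D X (D Y W)) - m Z (D Y (D X W))
  - m (D (bracket X Y) Z) W.
  apply: (addrI (m (D (bracket X Y) Z) W)); rewrite H; ring.
ring.
Qed.

(** Vanishing torsion turns the cyclic sum into iterated brackets, which cancel by the Jacobi
    identity. *)
Lemma curvature4_bianchi X Y Z W :
  curvature4 g D X Y Z W + curvature4 g D Y Z X W + curvature4 g D Z X Y W = 0.
Proof.
rewrite /curvature4 /curvature !metricE.
rewrite (torsion_swap X Y) (torsion_swap Y Z) (torsion_swap Z X).
rewrite !(connectionDr cD) !connectionNr.
rewrite (torsion_swap (bracket X Y) Z) (torsion_swap (bracket Y Z) X).
rewrite (torsion_swap (bracket Z X) Y) !metricE.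
rewrite (bracketC (bracket Y Z) X) (bracket_jacobi X Y Z).
rewrite (bracketC (bracket Z X) Y) (bracketC (bracket X Y) Z) !metricE.
ring.
Qed.

(** The classical combination of four Bianchi identities, one for each choice of last argument, with
    both skew-symmetries. *)
Lemma curvature4_pair X Y Z W :
  curvature4 g D X Y Z W = curvature4 g D Z W X Y.
Proof.
(* Evaluation at a point leaves a linear problem over the reals, where division by 2 is
   available. *)
apply: smooth_funP => p.
have sl X1 Y1 Z1 W1 : curvature4 g D X1 Y1 Z1 W1 p = - curvature4 g D Y1 X1 Z1 W1 p.
  by rewrite (curvature4_skewl _ _ _ _ cD).
have sr X1 Y1 Z1 W1 : curvature4 g D X1 Y1 Z1 W1 p = - curvature4 g D X1 Y1 W1 Z1 p.
  by rewrite (curvature4_skewr X1 Y1 Z1 W1).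
have bi X1 Y1 Z1 W1 : curvature4 g D X1 Y1 Z1 W1 p +
    curvature4 g D Y1 Z1 X1 W1 p + curvature4 g D Z1 X1 Y1 W1 p = 0.
  exact: (congr1 (fun f : F => f p) (curvature4_bianchi X1 Y1 Z1 W1)).
have := bi X Y Z W; have := bi Y Z W X; have := bi Z W X Y; have := bi W X Y Z.
rewrite (sr Y Z W X) (sr Z W Y X) (sr W X Z Y) (sr X Y W Z).
rewrite (sl X Z W Y) (sr Z X W Y) (sl Y W X Z) (sr W Y X Z).
by move: (curvature4 _ _ _ _ _ _) => *; lra.
Qed.

End LeviCivita.

(** * Curvature and Ricci tensor of the connection with vectorial torsion *)

Section VectorialTorsion.
Context {R : realType} {n : nat} {M : manifold R n} (g : semi_metric M).
Context (D : vfield M -> vfield M -> vfield M) (lcD : is_levi_civita g D).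
Context (V : vfield M).
Notation m := (Defs.metric g).
Notation nabla := (vectorial_connection g D V).
Notation dV := (dform (flat g V)).
Implicit Types X Y Z W : vfield M.
Let cD : is_connection D := levi_civita_connection lcD.

(** The form [A] of the opening overview. Its second summand is symmetric, so only [g(D_X V, W)]
    contributes to the exterior derivative of [flat g V]. *)
Definition torsion_form X W := m (D X V) W + m V X * m V W.

(** Apart from the Levi-Civita curvature, the terms with derivatives of [X], [Y] or [Z] cancel once
    [D Y X] is written through [D X Y] and the bracket. *)
Lemma vectorial_curvature4 X Y Z W :
  curvature4 g nabla X Y Z W = curvature4 g D X Y Z W +
    (m Y Z * torsion_form X W - m X Z * torsion_form Y W
     - torsion_form X Z * m Y W + torsion_form Y Z * m X W
     - m V V * (m Y Z * m X W - m X Z * m Y W)).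
Proof.
rewrite /curvature4 /curvature /vectorial_connection /torsion_form.
rewrite !(connectionDr cD) !(connectionNr lcD) !(connectionZr cD).
rewrite !(vact_metric lcD) !metricE !(torsion_swap lcD X Y) !metricE.
rewrite !(metricC _ V) !(metricC _ Y X).
ring.
Qed.

Lemma dform_flat X Y : dV X Y = torsion_form X Y - torsion_form Y X.
Proof.
rewrite /dform /flat !(vact_metric lcD) -(levi_civita_torsion lcD) /torsion_form.
rewrite !metricE; ring.
Qed.

Lemma vectorial_curvature4_skewl X Y Z W :
  curvature4 g nabla X Y Z W = - curvature4 g nabla Y X Z W.
Proof. rewrite !vectorial_curvature4 (curvature4_skewl _ X Y _ _ cD); ring. Qed.

Lemma vectorial_curvature4_skewr X Y Z W :
  curvature4 g nabla X Y Z W = - curvature4 g nabla X Y W Z.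
Proof. rewrite !vectorial_curvature4 (curvature4_skewr lcD X Y Z W); ring. Qed.

Lemma vectorial_curvature4_swap X Y Z W :
  curvature4 g nabla X Y Z W - curvature4 g nabla Z W X Y =
  m Y Z * dV X W - m Y W * dV X Z - m X Z * dV Y W + m X W * dV Y Z.
Proof.
rewrite !vectorial_curvature4 !dform_flat (curvature4_pair lcD X Y Z W).
rewrite (metricC _ Z X) (metricC _ Z Y) (metricC _ W X) (metricC _ W Y).
ring.
Qed.

Lemma dform_flatC X Y : dV X Y = - dV Y X.
Proof. by rewrite !dform_flat opprB. Qed.

(** Term by term, [R^V(X, e, e, Y) = R^V(e, Y, X, e) = R^V(Y, e, e, X)], by the pair symmetry and
    then both skew-symmetries. *)
Lemma ricci_sym_of_pair (p : M) X Y :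
  (forall X Y Z W, curvature4 g nabla X Y Z W = curvature4 g nabla Z W X Y) ->
  ricci g nabla X Y p = ricci g nabla Y X p.
Proof.
move=> pair; rewrite /ricci; case: (local_frame g p) => e eps.
apply: eq_bigr => i _; congr (_ * _).
have YX : curvature4 g nabla X (e i) (e i) Y = curvature4 g nabla Y (e i) (e i) X.
  rewrite [RHS]vectorial_curvature4_skewl [in RHS]vectorial_curvature4_skewr opprK.
  exact: pair.
exact: (congr1 (fun f : smooth_fun M => f p) YX).
Qed.

Lemma ricci_skew (p : M) (U : set M) e eps X Y :
  local_frame g p = (e, eps) -> U p -> orthonormal_frame g U e eps ->
  ricci g nabla X Y p - ricci g nabla Y X p =
  n%:R * dV X Y p - \sum_i eps i * (m (e i) Y p * dV X (e i) p)
    - \sum_i eps i * (m X (e i) p * dV (e i) Y p).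
Proof.
move=> fr Up [eps1 one]; rewrite /ricci fr -sumrB.
have -> : n%:R * dV X Y p = \sum_(i < n) dV X Y p.
  by rewrite sumr_const card_ord mulr_natl.
rewrite -!sumrB; apply: eq_bigr => i _.
(* After two sign changes the subtracted curvature is the summand of the transposed Ricci tensor.
   Since [eps i * eps i = 1], each index contributes [dV X Y] once, hence the factor [n]. *)
have XY := vectorial_curvature4_swap X (e i) (e i) Y.
have d0 : dV (e i) (e i) = 0 by rewrite dform_flat subrr.
rewrite [curvature4 g nabla (e i) Y X (e i)]vectorial_curvature4_skewl in XY.
rewrite [curvature4 g nabla Y (e i) X (e i)]vectorial_curvature4_skewr opprK in XY.
rewrite d0 mulr0 addr0 in XY.
have {}XY := congr1 (fun f : smooth_fun M => eps i * f p) XY.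
have ee := one p Up i i; rewrite eqxx mulr1n in ee.
rewrite !smooth_funBE !smooth_funME ee in XY.
rewrite -mulrBr [LHS]XY; move: (dV X Y p) (dV X (e i) p) (dV (e i) Y p) => x y z.
by rewrite !mulrBr (mulrA _ _ x) (pm1_sqr (eps1 i)) mul1r.
Qed.

Lemma dform_flat_eq0 : (2 < n)%N ->
  (forall X Y, ricci g nabla X Y = ricci g nabla Y X) -> forall X Y, dV X Y = 0.
Proof.
move=> n2 sym X Y; apply: smooth_funP => p.
case fr: (local_frame g p) => [e eps].
(* Existence of a frame near [p] ensures that [xget] returns a genuine frame and not its default
   value. *)
have [U [_ Up] one] : exists2 U, open_nbhs p U & orthonormal_frame g U e eps.
  change (frame_near g p (e, eps)); rewrite -fr.
  by apply: xgetPex; exact: frame_near_exists.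
have skew X' Y' := ricci_skew X' Y' fr Up one.
have [eps1 on] := one.
have delta a (f : 'I_n -> R) : \sum_i eps i * (m (e i) (e a) p * f i) = f a.
  rewrite (bigD1 a) // big1 => [|i /andP[_ ia]].
    rewrite on // eqxx mulr1n mulrA (pm1_sqr (eps1 a)) mul1r;
      exact: addr0.
  by rewrite on // (negbTE ia) mulr0n mul0r mulr0.
have delta' a (f : 'I_n -> R) : \sum_i eps i * (m (e a) (e i) p * f i) = f a.
  by rewrite -[RHS](delta a f); apply: eq_bigr => i _; rewrite metricC.
have n0 k : (k < n)%N -> n%:R - k%:R != 0 :> R.
  by move=> kn; rewrite subr_eq0 eqr_nat gtn_eqF.
(* For two frame fields both sums collapse to [dV (e a) (e b)], leaving the coefficient [n - 2]. *)
have Oee a b : dV (e a) (e b) p = 0.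
  have := skew (e a) (e b); rewrite sym subrr delta delta' => H.
  apply: (mulfI (n0 2%N n2)); rewrite mulr0 [RHS]H; ring.
(* Instead of expanding [Y'] in the frame, the traced identity is reused: by [Oee] the first sum is
   now zero, so the coefficient is [n - 1]. For general [X] and [Y] both sums vanish and it is
   [n]. *)
have OeY a Y' : dV (e a) Y' p = 0.
  have := skew (e a) Y'; rewrite sym subrr delta' big1 => [H|i _].
    apply: (mulfI (n0 1%N (ltnW n2))); rewrite mulr0 [RHS]H; ring.
  by rewrite Oee !mulr0.
have OXe a : dV X (e a) p = 0.
  by rewrite dform_flatC -sub0r smooth_funBE OeY subr0.
have := skew X Y; rewrite sym subrr !big1 => [H|i _|i _].
- by apply: (mulfI (n0 0%N (ltnW (ltnW n2)))); rewrite mulr0 [RHS]H; ring.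
- by rewrite OeY !mulr0.
- by rewrite OXe !mulr0.
Qed.

End VectorialTorsion.

Theorem proposition3p2 (R : realType) (n : nat) (M : manifold R n)
    (g : semi_metric M) (V : vfield M)
    (nablag : vfield M -> vfield M -> vfield M) :
  (2 < n)%N -> is_levi_civita g nablag ->
  let nabla := vectorial_connection g nablag V in
  [<-> (forall X Y Z W : vfield M,
          curvature4 g nabla X Y Z W = curvature4 g nabla Z W X Y);
       (forall X Y : vfield M, ricci g nabla X Y = ricci g nabla Y X);
       (forall X Y : vfield M, dform (flat g V) X Y = 0)].
Proof.
move=> n2 lcD nabla; tfae.
- by move=> pair X Y; apply/funext => p; exact: ricci_sym_of_pair.
- exact: dform_flat_eq0.
move=> closed X Y Z W; apply/eqP; rewrite -subr_eq0; apply/eqP.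
by rewrite vectorial_curvature4_swap // !closed !mulr0 !subr0 addr0.
Qed.
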